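(* Let $\lambda_1,\lambda_2,\lambda_3\in\mathbb{C}$ be such that $\sum_{i\in I}\lambda_i\notin\frac12\mathbb{Z}_{\ge0}$ for every nonempty $I\subseteq\{1,2,3\}$, and let $\lambda_{123}\in\lambda_1+\lambda_2+\lambda_3-\mathbb{Z}_{\ge0}$. Let $\mu,\nu$ be such that $\lambda_2+\lambda_3-\mu,\ \lambda_1+\mu-\lambda_{123},\ \lambda_2+\lambda_3-\nu,\ \lambda_1+\nu-\lambda_{123}\in\mathbb{Z}_{\ge0}$. Then $$\sum_\alpha\begin{Bmatrix}\lambda_1&\lambda_2&\alpha\\ \lambda_3&\lambda_{123}&\mu\end{Bmatrix}_q\begin{Bmatrix}\lambda_3&\lambda_2&\nu\\ \lambda_1&\lambda_{123}&\alpha\end{Bmatrix}_q=\delta_{\mu,\nu},$$ where the sum is over $\alpha=\lambda_1+\lambda_2-j$, $j=0,1,\ldots,\lambda_1+\lambda_2+\lambda_3-\lambda_{123}$.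
   Context: Notation: $q=e^{h/2}$ with $h\in\mathbb{C}$, $q^x:=e^{hx/2}$, $[x]_q=\frac{q^x-q^{-x}}{q-q^{-1}}$, $[n]_q!=\prod_{s=1}^n[s]_q$, $[0]_q!=1$, $(-1)^{J/2}:=e^{i\pi J/2}$. The parameter $q$ is generic: $[x]_q\neq0$ for every nonzero $x\in\mathbb{Z}+2\mathbb{Z}\lambda_1+2\mathbb{Z}\lambda_2+2\mathbb{Z}\lambda_3$. Terms with $[n]_q!$, $n$ a negative integer, in the denominator are omitted; empty products equal $1$. For $\mu\notin\frac12\mathbb{Z}_{\ge0}$ the Verma module $M_\mu$ of $U_q(\mathfrak{sl}_2)$ has basis $e^\mu_a$, $a\in\mu-\mathbb{Z}_{\ge0}$, with $Ke^\mu_a=q^{2a}e^\mu_a$, $Ee^\mu_a=[\mu-a]_qe^\mu_{a+1}$, $Fe^\mu_a=[\mu+a]_qe^\mu_{a-1}$; the coproduct is $\Delta E=E\otimes K+1\otimes E$, $\Delta F=F\otimes1+K^{-1}\otimes F$, $\Delta K=K\otimes K$. For $\mu=\mu_1+\mu_2-J$, $J\in\mathbb{Z}_{\ge0}$, the $q3j$-symbols $$\begin{bmatrix}\mu_1&\mu_2&\mu\\ a_1&a_2&a\end{bmatrix}^\psi_q=(-1)^{\frac J2+\mu_1-a_1}q^{(\mu_2^2-a_2^2)-(\mu^2-a^2)-(\mu_1-a_1)}\frac{[\mu-a]_q!\,\Delta(\mu_1,\mu_2,\mu)}{\prod_{j=1}^{\mu-a}[\mu+a+j]_q}\sum_{z+w=\mu-a}(-1)^zq^{z(\mu+a+1)}\frac{\prod_{j=1}^z[\mu_1+a_1+j]_q\prod_{j=1}^w[\mu_2+a_2+j]_q}{[z]_q![w]_q![\mu_1-a_1-z]_q![\mu_2-a_2-w]_q!}$$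 ($z,w\in\mathbb{Z}_{\ge0}$, $a=a_1+a_2$; zero otherwise) are the matrix coefficients of a module embedding $M_\mu\hookrightarrow M_{\mu_1}\otimes M_{\mu_2}$. Here $\Delta(\mu_1,\mu_2,\mu)=\Big([J]_q!\prod_{j=0}^{J-1}\frac{[2\mu_1-j]_q[2\mu_2-j]_q}{[2\mu+2+j]_q}\Big)^{1/2}$ with square roots fixed once and for all so that $\Delta(\mu_1,\mu_2,\mu)=\Delta(\mu_2,\mu_1,\mu)$. $q6j$-symbols: for an ordered triple $(\mu_1,\mu_2,\mu_3)$ of weights define in $M_{\mu_1}\otimes M_{\mu_2}\otimes M_{\mu_3}$ $$e^{\mu_{12},\mu}_a=\sum_{a_1+a_2+a_3=a}\begin{bmatrix}\mu_{12}&\mu_3&\mu\\ a_1+a_2&a_3&a\end{bmatrix}^\psi_q\begin{bmatrix}\mu_1&\mu_2&\mu_{12}\\ a_1&a_2&a_1+a_2\end{bmatrix}^\psi_qe^{\mu_1}_{a_1}\otimes e^{\mu_2}_{a_2}\otimes e^{\mu_3}_{a_3},$$ $$e^{\mu_{23},\mu}_a=\sum_{a_1+a_2+a_3=a}\begin{bmatrix}\mu_1&\mu_{23}&\mu\\ a_1&a_2+a_3&a\end{bmatrix}^\psi_q\begin{bmatrix}\mu_2&\mu_3&\mu_{23}\\ a_2&a_3&a_2+a_3\end{bmatrix}^\psi_qe^{\mu_1}_{a_1}\otimes e^{\mu_2}_{a_2}\otimes e^{\mu_3}_{a_3}$$ ($3j$-symbols being $0$ when a weight does not occur in the corresponding module).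 For $\mu_1+\mu_2-\mu_{12},\mu_{12}+\mu_3-\mu\in\mathbb{Z}_{\ge0}$, the $q6j$-symbols are the coefficients (independent of $a$) in $$e^{\mu_{12},\mu}_a=\sum_{\mu_{23}}\begin{Bmatrix}\mu_1&\mu_2&\mu_{12}\\ \mu_3&\mu&\mu_{23}\end{Bmatrix}_qe^{\mu_{23},\mu}_a,$$ the sum being over $\mu_{23}$ with $\mu_2+\mu_3-\mu_{23},\ \mu_1+\mu_{23}-\mu\in\mathbb{Z}_{\ge0}$. *)

(* Defs.v *)
From HB Require Import structures.
From mathcomp Require Import all_boot all_order all_algebra.
From mathcomp Require Import all_classical all_reals all_analysis.
From mathcomp Require Import complex.

Set Implicit Arguments.
Unset Strict Implicit.
Unset Printing Implicit Defensive.

Import Order.TTheory GRing.Theory Num.Theory.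

Local Open Scope classical_set_scope.
Local Open Scope ring_scope.
Local Open Scope complex_scope.

Section Nat_in_complex.
Context {R : realType}.
Implicit Types (x : R[i]) (n : nat).

(* [natC n%:R = n]; the value on other complex numbers is irrelevant. *)
Definition natC x : nat := Num.truncn (complex.Re x).

Definition is_natC x : bool := x == (natC x)%:R.

Lemma natCE n : natC n%:R = n.
Proof.
rewrite /natC -[n%:R](rmorph_nat (real_complex R)) /=.
by apply: truncn_def; rewrite lexx ltr_nat ltnSn.
Qed.

Lemma is_natCP x : reflect (exists n, x = n%:R) (is_natC x).
Proof.
apply: (iffP eqP) => [->|[n ->]]; first by exists (natC x).
by rewrite natCE.
Qed.

End Nat_in_complex.

Section QNumbers.
Context {R : realType}.
Implicit Types (h x z : R[i]) (n : nat).

Definition cexp z : R[i] :=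
  (expR (complex.Re z) * cos (complex.Im z))
    +i* (expR (complex.Re z) * sin (complex.Im z)).

(* The branch (-1)^x := e^{i pi x} *)
Definition m1pow x : R[i] := cexp ((0 +i* pi) * x).

(* q^x for q = e^{h/2}; q itself is [qpow h 1]. *)
Definition qpow h x : R[i] := cexp (h * x / 2).

(* When q = q^-1 this is 0 for all x (division by zero), so such h are
   excluded by [generic_q] below. *)
Definition qnum h x : R[i] :=
  (qpow h x - qpow h (- x)) / (qpow h 1 - qpow h (- 1)).

Definition qfact h n : R[i] := \prod_(1 <= s < n.+1) qnum h s%:R.

Definition generic_q h (l1 l2 l3 : R[i]) : Prop :=
  forall n n1 n2 n3 : int,
    let x := n%:~R + 2 * n1%:~R * l1 + 2 * n2%:~R * l2 + 2 * n3%:~R * l3 in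
    x != 0 -> qnum h x != 0.

End QNumbers.

Section Symbols.
Context {R : realType}.
Local Notation C := R[i].
Variable h : C.
Local Notation "[ x ]_q" := (qnum h x) (at level 0, x at level 99).
Local Notation "[ n ]_q!" := (qfact h n) (at level 0, n at level 99).
Implicit Types (m a : C).

(* D m1 m2 m is a choice of the square root Delta(m1, m2, m), symmetric in
   (m1, m2); it is constrained only where the radicand is defined. *)
Definition Delta_root (D : C -> C -> C -> C) : Prop :=
  forall m1 m2 (J : nat), let m := m1 + m2 - J%:R in
    (forall j : nat, (j < J)%N -> [2 * m + 2 + j%:R]_q != 0) ->
    D m1 m2 m ^+ 2 =
      [J]_q! * \prod_(0 <= j < J) ([2 * m1 - j%:R]_q * [2 * m2 - j%:R]_q
                                     / [2 * m + 2 + j%:R]_q)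
    /\ D m1 m2 m = D m2 m1 m.

Variable D : C -> C -> C -> C.

(* In the sum w = n - z; the conditions z <= k1 and w <= k2 drop the terms
   containing the factorial of a negative integer. *)
Definition q3j m1 m2 m a1 a2 a : C :=
  if [&& is_natC (m1 + m2 - m), is_natC (m1 - a1), is_natC (m2 - a2),
         is_natC (m - a) & a == a1 + a2]
  then
    let k1 := natC (m1 - a1) in
    let k2 := natC (m2 - a2) in
    let n := natC (m - a) in
    m1pow ((m1 + m2 - m) / 2 + m1 - a1)
    * qpow h ((m2 ^+ 2 - a2 ^+ 2) - (m ^+ 2 - a ^+ 2) - (m1 - a1))
    * ([n]_q! * D m1 m2 m / \prod_(1 <= j < n.+1) [m + a + j%:R]_q)
    * \sum_(0 <= z < n.+1 | (z <= k1)%N && (n - z <= k2)%N)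
        ((-1) ^+ z * qpow h (z%:R * (m + a + 1))
         * ((\prod_(1 <= j < z.+1) [m1 + a1 + j%:R]_q)
            * (\prod_(1 <= j < (n - z).+1) [m2 + a2 + j%:R]_q)
            / ([z]_q! * [(n - z)%N]_q! * [(k1 - z)%N]_q!
               * [(k2 - (n - z))%N]_q!)))
  else 0.

(* The vectors e^{m12,m}_a and e^{m23,m}_a of the tensor product of Verma
   modules M_m1 (x) M_m2 (x) M_m3, given by their coordinates in the basis
   e^m1_a1 (x) e^m2_a2 (x) e^m3_a3. *)
Definition evec12 m1 m2 m3 m12 m a : C -> C -> C -> C := fun a1 a2 a3 =>
  if a1 + a2 + a3 == a then
    q3j m12 m3 m (a1 + a2) a3 a * q3j m1 m2 m12 a1 a2 (a1 + a2)
  else 0.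

Definition evec23 m1 m2 m3 m23 m a : C -> C -> C -> C := fun a1 a2 a3 =>
  if a1 + a2 + a3 == a then
    q3j m1 m23 m a1 (a2 + a3) a * q3j m2 m3 m23 a2 a3 (a2 + a3)
  else 0.

Definition adm23 m1 m2 m3 m : set C :=
  [set m23 | is_natC (m2 + m3 - m23) /\ is_natC (m1 + m23 - m)].

Definition is_q6j_family m1 m2 m12 m3 m (c : C -> C) : Prop :=
  (forall m23, ~ adm23 m1 m2 m3 m m23 -> c m23 = 0) /\
  (forall a, is_natC (m - a) -> forall a1 a2 a3,
     evec12 m1 m2 m3 m12 m a a1 a2 a3 =
     \sum_(m23 \in adm23 m1 m2 m3 m)
        (c m23 * evec23 m1 m2 m3 m23 m a a1 a2 a3)).

(* The q6j-symbol { m1 m2 m12 ; m3 m m23 }_q; the junk value is 0 if no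
   coefficient family exists. *)
Definition q6j m1 m2 m12 m3 m m23 : C :=
  xget (fun=> 0) [set c | is_q6j_family m1 m2 m12 m3 m c] m23.

End Symbols.

(* Main.v *)
(* A highest weight vector of a triple product M_m1 (x) M_m2 (x) M_m3 is
   determined by its coordinates on the slice a3 = m3, where the vectors e^(m23)
   form a triangular system; so the 6j-symbols exist, and an identity between
   combinations of the e^(m23) may be checked on that slice. The quasi-R-matrix
   Theta of the first two factors preserves the slice and carries e^(m12) and
   e^(m23) at q to the same vectors at q^-1, with one common scalar q^(-2N), so
   the 6j-symbols at q also expand e^(m12) in e^(m23) at q^-1. Reversing the
   order of the three factors exchanges e^(m12) at q with e^(m23) at q^-1, up to
   a factor which does not involve the intermediate weight. Hence the symbols of
   (l3, l2, l1) expand e^(m23) in e^(m12) at q^-1, and the two matrices are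
   inverse to each other. *)
Require Import Defs.
From HB Require Import structures.
From mathcomp Require Import all_boot all_order all_algebra.
From mathcomp Require Import all_classical all_reals all_analysis.
From mathcomp Require Import complex ring.

Set Implicit Arguments.
Unset Strict Implicit.
Unset Printing Implicit Defensive.

Import Order.TTheory GRing.Theory Num.Theory.
Local Open Scope ring_scope.
Local Open Scope complex_scope.

(** * q-numbers and q-binomial coefficients *)

(** Why [theta] on two factors suffices for three: the quasi-R-matrix of a triple product is
    Theta_12 times a factor whose nontrivial terms lower the third tensor factor, and these cannot
    contribute at the top coordinate a3 = m3. So on the slice Theta_12 is the shadow of an
    intertwiner from the coproduct at q to the one at q^-1. The three-factor operator is never
    built: for e^(m12) the claim reduces to the inner pair, and for e^(m23) both 3j-symbols are
    single products on the slice, so that a finite q-binomial identity remains. The scalar is common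
    because Theta rescales a coupling of weights x, y to z by q^(-2(x+y-z)), and over two couplings
    these exponents add up to -2N whatever the intermediate weight. Inverting q means replacing h by
    -h. The q-numbers are even in h, hence so is the radicand of Delta, and one choice [D] of square
    roots serves both parameters; the 6j-symbols at q^-1 are never formed. *)

Section Exponential.
Context {R : realType}.
Implicit Types (h x y z : R[i]) (n : nat).

Lemma cexp0 : cexp 0 = 1 :> R[i].
Proof. by rewrite /cexp /= expR0 cos0 sin0 mulr1 mulr0. Qed.

Lemma cexpD x y : cexp (x + y) = cexp x * cexp y.
Proof.
case: x y => [a b] [c d]; rewrite /cexp /= expRD cosD sinD.
by apply/eqP; rewrite eq_complex /=; apply/andP; split; apply/eqP; ring.
Qed.

Lemma cexp_neq0 x : cexp x != 0.
Proof.
apply/eqP => x0; have := cexpD x (- x).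
by rewrite subrr cexp0 x0 mul0r => /eqP; rewrite oner_eq0.
Qed.

Lemma m1powD x y : m1pow (x + y) = m1pow x * m1pow y.
Proof. by rewrite /m1pow mulrDr cexpD. Qed.

Lemma m1pow0 : m1pow 0 = 1 :> R[i].
Proof. by rewrite /m1pow mulr0 cexp0. Qed.

Lemma m1pow_neq0 x : m1pow x != 0.
Proof. exact: cexp_neq0. Qed.

Lemma m1pow1 : m1pow 1 = -1 :> R[i].
Proof.
rewrite /m1pow mulr1 /cexp /= expR0 cospi sinpi !mul1r.
by apply/eqP; rewrite eq_complex /= oppr0 !eqxx.
Qed.

Lemma m1pow_nat n : m1pow n%:R = (-1) ^+ n :> R[i].
Proof.
elim: n => [|n IHn]; first by rewrite m1pow0.
by rewrite -addn1 natrD m1powD IHn m1pow1 addn1 exprSr.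
Qed.

Lemma qpowD h x y : qpow h (x + y) = qpow h x * qpow h y.
Proof. by rewrite /qpow -cexpD -mulrDl -mulrDr. Qed.

Lemma qpow0 h : qpow h 0 = 1.
Proof. by rewrite /qpow mulr0 mul0r cexp0. Qed.

Lemma qpow_neq0 h x : qpow h x != 0.
Proof. exact: cexp_neq0. Qed.

Lemma qpowN h x : qpow h (- x) = (qpow h x)^-1.
Proof.
apply: (mulfI (qpow_neq0 h x)).
by rewrite -qpowD subrr qpow0 mulfV ?qpow_neq0.
Qed.

Lemma qpow_opp h x : qpow (- h) x = qpow h (- x).
Proof. by rewrite /qpow mulNr mulrN. Qed.

End Exponential.

Section NatInComplex.
Context {R : realType}.
Implicit Types (x : R[i]) (n : nat).

Lemma is_natC_nat n : is_natC (n%:R : R[i]).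
Proof. by apply/is_natCP; exists n. Qed.

Lemma is_natCD x n : is_natC x -> is_natC (x + n%:R).
Proof. by case/is_natCP => k ->; rewrite -natrD is_natC_nat. Qed.

Lemma is_natCB x n : is_natC (x - n%:R) -> is_natC x.
Proof. by move/(is_natCD n); rewrite subrK. Qed.

Lemma is_natCBnat m n : is_natC (m%:R - n%:R : R[i]) = (n <= m)%N.
Proof.
apply/is_natCP/idP => [[k /eqP]|lenm]; last by exists (m - n)%N; rewrite natrB.
by rewrite subr_eq -natrD eqr_nat => /eqP ->; rewrite leq_addl.
Qed.

Lemma natCBnat m n : (n <= m)%N -> natC (m%:R - n%:R : R[i]) = (m - n)%N.
Proof. by move=> lenm; rewrite -natrB // natCE. Qed.

End NatInComplex.

Section QCalculus.
Context {R : realType}.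
Variable h : R[i].
Implicit Types (x y z : R[i]) (n k : nat).

Definition qstep : R[i] := qpow h 1 - qpow h (- 1).

Lemma qnumE x : qnum h x = (qpow h x - qpow h (- x)) / qstep.
Proof. by []. Qed.

Lemma qnum0 : qnum h 0 = 0.
Proof. by rewrite qnumE oppr0 subrr mul0r. Qed.

Lemma qnumN x : qnum h (- x) = - qnum h x.
Proof. by rewrite !qnumE opprK -mulNr opprB. Qed.

Lemma qnum_opp x : qnum (- h) x = qnum h x.
Proof.
rewrite /qnum !qpow_opp !opprK -[_ - qpow h 1]opprB -[_ - qpow h x]opprB.
by rewrite invrN mulrNN.
Qed.

Lemma qfact_opp n : qfact (- h) n = qfact h n.
Proof. by apply: eq_bigr => i _; rewrite qnum_opp. Qed.

Lemma qnumD x y : qnum h (x + y) = qpow h y * qnum h x + qpow h (- x) * qnum h y.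
Proof.
rewrite !qnumE opprD !qpowD !qpowN.
have := qpow_neq0 h x; have := qpow_neq0 h y.
move: (qpow h x) (qpow h y) (qstep^-1) => X Y d Y0 X0.
by field; rewrite X0 Y0.
Qed.

Definition qprod x n : R[i] := \prod_(1 <= j < n.+1) qnum h (x + j%:R).

Lemma qprod0 x : qprod x 0 = 1.
Proof. by rewrite /qprod big_geq. Qed.

Lemma qprodS x n : qprod x n.+1 = qprod x n * qnum h (x + n.+1%:R).
Proof. by rewrite /qprod big_nat_recr. Qed.

Lemma qprodSl x n : qprod x n.+1 = qnum h (x + 1) * qprod (x + 1) n.
Proof.
rewrite /qprod big_nat_recl //; congr (_ * _); apply: eq_bigr => i _.
by congr (qnum h _); rewrite -addrA -[1]/(1%:R) -natrD.
Qed.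

Lemma qprodD x m n : qprod x (m + n) = qprod x m * qprod (x + m%:R) n.
Proof.
elim: n => [|n IHn]; first by rewrite addn0 qprod0 mulr1.
by rewrite addnS !qprodS IHn -mulrA -addrA -natrD addnS.
Qed.

Lemma qprod_neq0 x n : (forall j, (0 < j <= n)%N -> qnum h (x + j%:R) != 0) ->
  qprod x n != 0.
Proof.
move=> nz; rewrite /qprod prodf_seq_neq0; apply/allP => j.
by rewrite mem_index_iota ltnS => /nz ->.
Qed.

Lemma qfact0 : qfact h 0 = 1. Proof. by rewrite /qfact big_geq. Qed.

Lemma qfactS n : qfact h n.+1 = qfact h n * qnum h n.+1%:R.
Proof. by rewrite /qfact big_nat_recr. Qed.

(* The q-Pascal rule fixes the boundary values 0 for k > n, so the truncated
   n - k never matters there. *)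
Fixpoint qbin n k : R[i] :=
  match n, k with
  | _, 0%N => 1
  | 0%N, _.+1 => 0
  | n'.+1, k'.+1 => qpow h (- (n' - k')%:R) * qbin n' k' + qpow h k'.+1%:R * qbin n' k'.+1
  end.

Lemma qbinn0 n : qbin n 0 = 1. Proof. by case: n. Qed.

Lemma qbin_small n k : (n < k)%N -> qbin n k = 0.
Proof.
elim: n k => [|n IHn] [|k] //=; rewrite ltnS => ltnk.
by rewrite !IHn ?mulr0 ?addr0 // ltnW.
Qed.

(** The q-Pascal rule moved from the binomials onto an arbitrary summand: an induction on n then
    only has to compare summands. *)
Lemma qbin_sum n (f : nat -> R[i]) :
  \sum_(0 <= z < n.+2) qbin n.+1 z * f z =
  \sum_(0 <= z < n.+1)
     qbin n z * (qpow h z%:R * f z + qpow h (- (n - z)%:R) * f z.+1).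
Proof.
rewrite big_nat_recl // qbinn0 mul1r /=.
under eq_bigr do rewrite mulrDl.
rewrite big_split /= [X in _ + (_ + X) = _]big_nat_recr //= qbin_small //.
rewrite mulr0 mul0r addr0 addrCA addrC.
under [in RHS]eq_bigr do rewrite mulrDr.
rewrite [in RHS]big_split /=; congr (_ + _); last first.
  by apply: eq_bigr => z _; rewrite mulrCA mulrA.
rewrite [RHS]big_nat_recl // qbinn0 qpow0 !mul1r; congr (_ + _).
by apply: eq_bigr => z _; rewrite mulrCA mulrA.
Qed.

Hypothesis nat_nz : forall n, qnum h n.+1%:R != 0.

Lemma qstep_neq0 : qstep != 0.
Proof.
apply/eqP => d0; have := nat_nz 0.
by rewrite qnumE d0 invr0 mulr0 eqxx.
Qed.

Lemma qfact_neq0 n : qfact h n != 0.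
Proof.
elim: n => [|n IHn]; first by rewrite qfact0 oner_neq0.
by rewrite qfactS mulf_neq0.
Qed.

Lemma qbinE n k : (k <= n)%N -> qbin n k = qfact h n / (qfact h k * qfact h (n - k)).
Proof.
elim: n k => [|n IHn] [|k] // lekn; rewrite ?qbinn0 ?subn0 ?qfact0 ?mul1r.
- by rewrite invr1.
- by rewrite divff ?qfact_neq0.
rewrite /= IHn // subSS.
have := qfact_neq0 k; have := nat_nz k; have := qfact_neq0 n.
move: lekn; rewrite ltnS leq_eqVlt => /predU1P[->|ltkn] fn sk fk.
  rewrite qbin_small // subnn qfact0 oppr0 qpow0 !mulr1 mul1r mulr0 addr0.
  by rewrite !divff ?qfact_neq0.
rewrite IHn // -(subnSK ltkn) !qfactS.
set w := (n - k.+1)%N; have := qfact_neq0 w; have := nat_nz w => sw fw.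
have -> : qnum h n.+1%:R = qpow h (- w.+1%:R) * qnum h k.+1%:R + qpow h k.+1%:R * qnum h w.+1%:R.
  rewrite addrC -qnumD -natrD; congr (qnum h _%:R).
  by rewrite /w subnSK // addnS subnK // ltnW.
move: (qpow h _) (qpow h _) => X Y.
by field; rewrite fk fw sk sw.
Qed.

End QCalculus.

(** * Highest weight vectors of a tensor product of two Verma modules *)

Section Operators.
Context {R : realType}.
Variables (h m1 m2 : R[i]).
Implicit Types (x y : R[i]) (n k : nat).

(* 1/[x]!, and 0 off the natural numbers: the omitted terms of the 3j-symbols
   vanish and the identities below hold for all complex indices. *)
Definition ifact x : R[i] := if is_natC x then (qfact h (natC x))^-1 else 0.

(* Vectors of M_m1 (x) M_m2 are given by their coordinates, so that F2 and E2
   read the coefficients of the coproducts of F and E backwards. *)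
Definition F2 (v : R[i] -> R[i] -> R[i]) a1 a2 : R[i] :=
  qnum h (m1 + a1 + 1) * v (a1 + 1) a2
  + qpow h (- (2 * a1)) * qnum h (m2 + a2 + 1) * v a1 (a2 + 1).

Definition E2 (v : R[i] -> R[i] -> R[i]) a1 a2 : R[i] :=
  qpow h (2 * a2) * qnum h (m1 - a1 + 1) * v (a1 - 1) a2
  + qnum h (m2 - a2 + 1) * v a1 (a2 - 1).

(** The 3j formula at a = m, where only z = 0 survives, without its normalisation [q3j_scale]. *)
Definition hwvec m a1 (a2 : R[i]) : R[i] :=
  if a1 + a2 == m then
    m1pow (m1 - a1) * qpow h (m2 ^+ 2 - a2 ^+ 2 - (m1 - a1))
    * ifact (m1 - a1) * ifact (m2 - a2)
  else 0.

(** The summands F (x) 1 and K^-1 (x) F of the coproduct q-commute, so its n-th power obeys the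
    q-binomial theorem; the power of q collects the action of the K^-1. *)
Lemma iter_F2 n v a1 a2 :
  iter n F2 v a1 a2 =
  \sum_(0 <= z < n.+1) qbin h n z *
    (qpow h (- ((n - z)%:R * (2 * a1 + z%:R)))
     * qprod h (m1 + a1) z * qprod h (m2 + a2) (n - z)
     * v (a1 + z%:R) (a2 + (n - z)%:R)).
Proof.
elim: n a1 a2 => [|n IHn] a1 a2.
  by rewrite big_nat1 qbinn0 mul0r oppr0 qpow0 !qprod0 !addr0 !mul1r.
rewrite iterS /F2 !IHn qbin_sum !big_distrr -big_split /=.
apply: eq_big_nat => z /andP[_]; rewrite ltnS => lezn.
rewrite subSS subSn // !qprodSl -!(addrA m1) -!(addrA m2).
set w := (n - z)%N; rewrite -[z.+1%:R]natr1 -[w.+1%:R]natr1.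
rewrite -!(addrA a1) -!(addrA a2) !(addrC 1 _%:R).
have -> : qpow h (- (w%:R * (2 * (a1 + 1) + z%:R)))
    = qpow h (- w%:R) * qpow h (- (w%:R * (2 * a1 + (z%:R + 1)))).
  by rewrite -qpowD; congr qpow; ring.
have e : qpow h z%:R * qpow h (- ((w%:R + 1) * (2 * a1 + z%:R)))
    = qpow h (- (2 * a1)) * qpow h (- (w%:R * (2 * a1 + z%:R))).
  by rewrite -!qpowD; congr qpow; ring.
by ring: e.
Qed.

Lemma eq_F2 (u v : R[i] -> R[i] -> R[i]) : u =2 v -> F2 u =2 F2 v.
Proof. by move=> uv a1 a2; rewrite /F2 !uv. Qed.

Lemma eq_E2 (u v : R[i] -> R[i] -> R[i]) : u =2 v -> E2 u =2 E2 v.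
Proof. by move=> uv a1 a2; rewrite /E2 !uv. Qed.

Lemma F2Z c v a1 a2 : F2 (fun x y => c * v x y) a1 a2 = c * F2 v a1 a2.
Proof. by rewrite /F2; ring. Qed.

Lemma E2Z c v a1 a2 : E2 (fun x y => c * v x y) a1 a2 = c * E2 v a1 a2.
Proof. by rewrite /E2; ring. Qed.

Hypothesis nat_nz : forall n, qnum h n.+1%:R != 0.

Lemma qnum1 : qnum h 1 = 1.
Proof. by rewrite qnumE divff // qstep_neq0. Qed.

Lemma qnumM x y z :
  qnum h (x + z) * qnum h (y + z) = qnum h x * qnum h y + qnum h z * qnum h (x + y + z).
Proof.
have := qstep_neq0 nat_nz; rewrite !qnumE !opprD !qpowD !qpowN.
have := qpow_neq0 h x; have := qpow_neq0 h y; have := qpow_neq0 h z.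
move: (qpow h x) (qpow h y) (qpow h z) (qstep h) => X Y Z d Z0 Y0 X0 d0.
by field; rewrite ?X0 ?Y0 ?Z0 ?d0.
Qed.

(** At x = m - a, y = m + a this is the commutator [E, F] on the single Verma module M_m. *)
Lemma qnumMB x y :
  qnum h (x + 1) * qnum h y = qnum h x * qnum h (y + 1) + qnum h (y - x).
Proof.
have := qnumM x (- y - 1) 1; rewrite subrK qnum1 mul1r.
have -> : - y - 1 = - (y + 1) by ring.
have -> : x - (y + 1) + 1 = - (y - x) by ring.
by rewrite !qnumN => /eqP; rewrite !mulrN -opprD eqr_opp => /eqP.
Qed.

Lemma comm_E2F2 v a1 a2 :
  E2 (F2 v) a1 a2 = F2 (E2 v) a1 a2 + qnum h (2 * (a1 + a2)) * v a1 a2.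
Proof.
rewrite /E2 /F2 !subrK !addrK.
have -> : m1 + (a1 - 1) + 1 = m1 + a1 by ring.
have -> : m2 + (a2 - 1) + 1 = m2 + a2 by ring.
have -> : m1 - (a1 + 1) + 1 = m1 - a1 by ring.
have -> : m2 - (a2 + 1) + 1 = m2 - a2 by ring.
have := qnumMB (m1 - a1) (m1 + a1); have := qnumMB (m2 - a2) (m2 + a2).
have -> : m1 + a1 - (m1 - a1) = 2 * a1 by ring.
have -> : m2 + a2 - (m2 - a2) = 2 * a2 by ring.
have -> : 2 * (a1 + a2) = 2 * a1 + 2 * a2 by ring.
have -> : 2 * (a2 + 1) = 2 * a2 + 2 by ring.
have -> : - (2 * (a1 - 1)) = - (2 * a1) + 2 by ring.
rewrite (qnumD _ (2 * a1)) !(qpowD _ _ 2) => e2 e1.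
by ring: e1 e2.
Qed.

Lemma qnum_ifact x : qnum h x * ifact x = ifact (x - 1).
Proof.
rewrite /ifact; case: (boolP (is_natC x)) => [/is_natCP[[|n] ->]|xN].
- by rewrite qnum0 mul0r -(mulr1n 1) is_natCBnat.
- rewrite -natr1 addrK natr1 is_natC_nat !natCE qfactS invfM mulrCA divff ?mulr1 //.
- by rewrite mulr0; case: ifP => // /(is_natCB (n := 1)); rewrite (negbTE xN).
Qed.

Lemma qprod_ifact x n : qprod h x n * ifact (x + n%:R) = ifact x.
Proof.
elim: n => [|n IHn]; first by rewrite qprod0 addr0 mul1r.
by rewrite qprodS -mulrA qnum_ifact -natr1 addrA addrK.
Qed.

(** The two terms cancel: [m1pow] changes sign between them, and the step of the quadratic exponent
    m2^2 - a2^2 absorbs the q^(2 a2) coming from E (x) K. *)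
Lemma E2_hwvec m a1 a2 : E2 (hwvec m) a1 a2 = 0.
Proof.
rewrite /E2 /hwvec.
have -> : a1 - 1 + a2 = a1 + a2 - 1 by ring.
have -> : a1 + (a2 - 1) = a1 + a2 - 1 by ring.
case: eqP => _; last by rewrite !mulr0 addr0.
have -> : m1 - (a1 - 1) = m1 - a1 + 1 by ring.
have -> : m2 - (a2 - 1) = m2 - a2 + 1 by ring.
have := qnum_ifact (m1 - a1 + 1); have := qnum_ifact (m2 - a2 + 1).
rewrite !addrK m1powD m1pow1 => e2 e1.
have e : qpow h (2 * a2) * qpow h (m2 ^+ 2 - a2 ^+ 2 - (m1 - a1 + 1))
   = qpow h (m2 ^+ 2 - (a2 - 1) ^+ 2 - (m1 - a1)).
  by rewrite -qpowD; congr qpow; ring.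
by rewrite -e -e1 -e2; ring.
Qed.

Lemma iter_F2_supp m n a1 a2 :
  iter n F2 (hwvec m) a1 a2 != 0 ->
  [/\ a1 + a2 = m - n%:R, is_natC (m1 - a1) & is_natC (m2 - a2)].
Proof.
elim: n a1 a2 => [|n IHn] a1 a2; last first.
  rewrite iterS /F2; have [->|nz1 _] := eqVneq (iter n F2 (hwvec m) (a1 + 1) a2) 0.
    rewrite mulr0 add0r mulf_eq0 negb_or => /andP[_ /IHn[e n1 n2]]; split => //.
      by rewrite -natr1 opprD addrA -e; ring.
    by apply: (is_natCB (n := 1)); rewrite -addrA -opprD.
  have [e n1 n2] := IHn _ _ nz1; split => //.
    by rewrite -natr1 opprD addrA -e; ring.
  by apply: (is_natCB (n := 1)); rewrite -addrA -opprD.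
rewrite /= /hwvec subr0; case: (a1 + a2 =P m) => [->|_]; last by rewrite eqxx.
rewrite !mulf_eq0 !negb_or /ifact => /andP[/andP[_ n1] n2]; split=> //.
  by move: n1; case: ifP => //; rewrite eqxx.
by move: n2; case: ifP => //; rewrite eqxx.
Qed.

(** Moving E through F^(n+1) leaves the sum of the weights [2(m - i)], i <= n, because E kills the
    highest weight vector; [qnumMB] sums them. *)
Lemma E2_iter_F2 m n a1 a2 :
  E2 (iter n.+1 F2 (hwvec m)) a1 a2
  = qnum h n.+1%:R * qnum h (2 * m - n%:R) * iter n F2 (hwvec m) a1 a2.
Proof.
elim: n a1 a2 => [|n IHn] a1 a2; rewrite iterS comm_E2F2.
  rewrite (_ : F2 (E2 _) a1 a2 = 0) ?add0r; last by rewrite /F2 /= !E2_hwvec !mulr0 addr0.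
  rewrite qnum1 mul1r subr0; rewrite -[iter 0 _ _]/(hwvec m).
  have [e|] := eqVneq (hwvec m a1 a2) 0; first by rewrite e !mulr0.
  by case/(@iter_F2_supp m 0) => ->; rewrite subr0.
rewrite (eq_F2 IHn) F2Z -iterS -mulrDl.
have [->|/iter_F2_supp[-> _ _]] := eqVneq (iter n.+1 F2 (hwvec m) a1 a2) 0.
  by rewrite !mulr0.
congr (_ * _).
have := qnumMB n.+1%:R (2 * m - n.+1%:R); rewrite natr1 => ->.
by congr (_ * qnum h _ + qnum h _); rewrite -natr1; ring.
Qed.

End Operators.

(** * The 3j-symbols *)

Section Symbols3j.
Context {R : realType}.
Variables (h : R[i]) (D : R[i] -> R[i] -> R[i] -> R[i]).
Implicit Types (x y m a : R[i]) (n k J : nat).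

Lemma q3j_supp m1 m2 m a1 a2 a : q3j h D m1 m2 m a1 a2 a != 0 ->
  [/\ is_natC (m1 + m2 - m), is_natC (m1 - a1), is_natC (m2 - a2),
      is_natC (m - a) & a = a1 + a2].
Proof. by rewrite /q3j; case: ifP => [/and5P[? ? ? ? /eqP] //|]; rewrite eqxx. Qed.

Lemma q3j_eq0 m1 m2 m a1 a2 a : ~~ is_natC (m - a) -> q3j h D m1 m2 m a1 a2 a = 0.
Proof. by move=> N; apply: contraNeq N => /q3j_supp[]. Qed.

Lemma q3j_eq0' m1 m2 m a1 a2 a : ~~ is_natC (m1 - a1) -> q3j h D m1 m2 m a1 a2 a = 0.
Proof. by move=> N; apply: contraNeq N => /q3j_supp[]. Qed.

(** The part of a 3j-symbol that depends neither on the indices a1, a2, a nor on h, hence is shared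
    by q and q^-1. *)
Definition q3j_scale m1 m2 m : R[i] := m1pow ((m1 + m2 - m) / 2) * D m1 m2 m.

Lemma ifact_natB k z : ifact h (k%:R - z%:R) = if (z <= k)%N then (qfact h (k - z))^-1 else 0.
Proof. by rewrite /ifact is_natCBnat; case: ifP => // lezk; rewrite natCBnat. Qed.

Hypothesis nat_nz : forall n, qnum h n.+1%:R != 0.

(** The defining sum is the q-binomial expansion [iter_F2] of F^n on the highest weight vector, and
    the denominator [2m - n + 1]...[2m] is the factor by which F^n takes e^m_m to e^m_(m-n). *)
Lemma q3jE m1 m2 m n a1 a2 : is_natC (m1 + m2 - m) ->
  q3j h D m1 m2 m a1 a2 (m - n%:R)
  = q3j_scale m1 m2 m / qprod h (2 * m - n%:R) n
    * iter n (F2 h m1 m2) (hwvec h m1 m2 m) a1 a2.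
Proof.
move=> Jn; rewrite /q3j Jn /=.
have -> : m - (m - n%:R) = n%:R by ring.
rewrite is_natC_nat natCE /=.
case: ifP => [/and3P[k1n k2n /eqP ea]|cF]; last first.
  rewrite [iter _ _ _ _ _](_ : _ = 0) ?mulr0 //; apply: contraFeq cF.
  by case/iter_F2_supp=> -> -> ->; rewrite eqxx.
rewrite iter_F2 [X in _ * X = _]big_mkcond /= !big_distrr /=; apply: eq_big_nat => z /andP[_].
rewrite ltnS => lezn; case/is_natCP: k1n k2n => [k1 e1] /is_natCP[k2 e2].
rewrite e1 e2 !natCE qbinE // /hwvec.
have -> : a1 + z%:R + (a2 + (n - z)%:R) = m.
  by rewrite addrACA -natrD subnKC // -ea subrK.
rewrite eqxx.
have -> : m1 - (a1 + z%:R) = k1%:R - z%:R by rewrite opprD addrA e1.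
have -> : m2 - (a2 + (n - z)%:R) = k2%:R - (n - z)%:R by rewrite opprD addrA e2.
rewrite !ifact_natB; case: (z <= k1)%N; last by rewrite /= ?(mulr0, mul0r).
case: (n - z <= k2)%N; last by rewrite /= ?(mulr0, mul0r).
have -> : m1pow ((m1 + m2 - m) / 2 + m1 - a1)
   = m1pow ((m1 + m2 - m) / 2) * m1pow (k1%:R - z%:R) * (-1) ^+ z.
  by rewrite -m1pow_nat -!m1powD -e1; congr m1pow; ring.
rewrite -/(qprod h (m + (m - n%:R)) n) -/(qprod h (m1 + a1) z) -/(qprod h (m2 + a2) (n - z)).
have -> : m + (m - n%:R) = 2 * m - n%:R by ring.
have eE : qpow h (- ((n - z)%:R * (2 * a1 + z%:R)))
          * qpow h (m2 ^+ 2 - (a2 + (n - z)%:R) ^+ 2 - (k1%:R - z%:R))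
   = qpow h (m2 ^+ 2 - a2 ^+ 2 - (m ^+ 2 - (m - n%:R) ^+ 2) - k1%:R)
     * qpow h (z%:R * (2 * m - n%:R + 1)).
  rewrite -!qpowD -e1 natrB //; congr qpow.
  have -> : m = a1 + a2 + n%:R by rewrite -ea subrK.
  by ring.
have ss : (-1) ^+ z * (-1) ^+ z = 1 :> R[i] by rewrite -expr2 sqrr_sign.
rewrite /q3j_scale !invfM /=.
move: ((qprod h (2 * m - n%:R) n)^-1) (qfact h n) => P N.
by ring: eE ss.
Qed.

Lemma E2_q3j m1 m2 m a a1 a2 : (forall n, qnum h (2 * m - n%:R) != 0) ->
  E2 h m1 m2 (fun x y => q3j h D m1 m2 m x y a) a1 a2
  = qnum h (m - a) * q3j h D m1 m2 m a1 a2 (a + 1).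
Proof.
move=> regm.
have [Jn|JN] := boolP (is_natC (m1 + m2 - m)); last first.
  have z x y b : q3j h D m1 m2 m x y b = 0 by apply: contraNeq JN => /q3j_supp[].
  by rewrite /E2 !z !mulr0 addr0.
have [/is_natCP[n e]|aN] := boolP (is_natC (m - a)); last first.
  rewrite /E2 !q3j_eq0 ?mulr0 ?addr0 //.
  by rewrite opprD addrA; apply: contra aN; apply: (is_natCB (n := 1)).
rewrite e; have -> : a = m - n%:R by rewrite -e; ring.
rewrite (eq_E2 h m1 m2 (fun x y => q3jE n x y Jn)) E2Z.
case: n {e} => [|n]; first by rewrite E2_hwvec // mulr0 qnum0 mul0r.
rewrite E2_iter_F2 //.
have -> : m - n.+1%:R + 1 = m - n%:R by rewrite -natr1; ring.
rewrite q3jE // qprodSl.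
have -> : 2 * m - n.+1%:R + 1 = 2 * m - n%:R by rewrite -natr1; ring.
have rn := regm n.
have -> : (qprod h (2 * m - n%:R) n)^-1
  = qnum h (2 * m - n%:R) * (qnum h (2 * m - n%:R) * qprod h (2 * m - n%:R) n)^-1.
  by rewrite invfM mulrA mulfV // mul1r.
by ring.
Qed.

(** The naturality of m - a excludes a = m + 1, where the left side is 0 but a - 1 = m is again a
    weight. For E the factor [m - a] closes the string at a = m. *)
Lemma F2_q3j m1 m2 m a a1 a2 : (forall n, qnum h (2 * m - n%:R) != 0) ->
  is_natC (m - a) ->
  F2 h m1 m2 (fun x y => q3j h D m1 m2 m x y a) a1 a2
  = qnum h (m + a) * q3j h D m1 m2 m a1 a2 (a - 1).
Proof.
move=> regm.
have [Jn|JN] := boolP (is_natC (m1 + m2 - m)); last first.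
  have z x y b : q3j h D m1 m2 m x y b = 0 by apply: contraNeq JN => /q3j_supp[].
  by rewrite /F2 !z !mulr0 addr0.
case/is_natCP=> n e; have -> : a = m - n%:R by rewrite -e; ring.
rewrite (eq_F2 h m1 m2 (fun x y => q3jE n x y Jn)) F2Z -iterS.
have -> : m - n%:R - 1 = m - n.+1%:R by rewrite -natr1; ring.
rewrite q3jE // qprodSl.
have -> : 2 * m - n.+1%:R + 1 = 2 * m - n%:R by rewrite -natr1; ring.
have -> : m + (m - n%:R) = 2 * m - n%:R by ring.
have rn := regm n.
have -> : (qprod h (2 * m - n%:R) n)^-1
  = qnum h (2 * m - n%:R) * (qnum h (2 * m - n%:R) * qprod h (2 * m - n%:R) n)^-1.
  by rewrite invfM mulrA mulfV // mul1r.
by ring.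
Qed.

(* The factor q^(2 a1 a2) is the Cartan part of the R-matrix; without it
   swapping the two tensor factors amounts to q <-> q^-1. *)
Lemma q3j_swap m1 m2 m J a1 a2 a : m = m1 + m2 - J%:R -> D m1 m2 m = D m2 m1 m ->
  q3j h D m1 m2 m a1 a2 a
  = (-1) ^+ J * qpow h (m1 * (m1 - 1) + m2 * (m2 - 1) - m * (m - 1) + 2 * a1 * a2)
    * q3j (- h) D m2 m1 m a2 a1 a.
Proof.
move=> em eD; rewrite /q3j (addrC m2 m1) (addrC a2 a1).
(* After replacing the q-numbers and q-factorials, which are even in h, the sign of h is visible
   only in powers of q. *)
move: (- h) (funext (qnum_opp h)) (funext (qfact_opp h)) (qpow_opp h) => h'.
move: (qnum h') (qfact h') => f g -> -> {f g} qpowO.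
case: (boolP (is_natC (m1 - a1))) => [|_]; last by rewrite /= !andbF mulr0.
case: (boolP (is_natC (m2 - a2))) => [|_]; last by rewrite /= !andbF mulr0.
case/is_natCP=> k2 e2; case/is_natCP=> k1 e1.
case: ifP => [/and5P[_ _ _ /is_natCP[n en] /eqP ea]|_]; last by rewrite mulr0.
have -> : m1 + m2 - m = J%:R by rewrite em; ring.
rewrite en ea e1 e2 !natCE -eD.
have ek : (k1 + k2 = J + n)%N.
  apply/eqP; rewrite -(eqr_nat R[i]) !natrD -e1 -e2 -en em ea; apply/eqP; ring.
have eqP0 (x : R[i]) k : \prod_(1 <= j < k.+1) qnum h (x + j%:R) = qprod h x k by [].
rewrite [X in _ * X = _]big_mkcond [X in _ = _ * (_ * X)]big_mkcond.
(* Swapping the two factors exchanges z with w = n - z, so the sums are matched term by term after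
   reversing one of them. *)
rewrite [X in _ = _ * (_ * X)]big_nat_rev !big_distrr /= add0n.
apply: eq_big_nat => z /andP[_]; rewrite ltnS => lezn.
rewrite !eqP0 !subSS subKn // andbC; case: ifP => _; last by rewrite !mulr0.
rewrite !qpowO.
have -> : m1pow (J%:R / 2 + m1 - a1) = m1pow (J%:R / 2) * (-1) ^+ k1 :> R[i].
  by rewrite -m1pow_nat -m1powD -e1 addrA.
have -> : m1pow (J%:R / 2 + m2 - a2) = m1pow (J%:R / 2) * (-1) ^+ k2 :> R[i].
  by rewrite -m1pow_nat -m1powD -e2 addrA.
have eS : (-1) ^+ k1 * (-1) ^+ z = (-1) ^+ J * (-1) ^+ k2 * (-1) ^+ (n - z) :> R[i].
  have -> : ((-1) ^+ k1 : R[i]) = (-1) ^+ J * (-1) ^+ k2 * (-1) ^+ n.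
    transitivity ((-1) ^+ k1 * ((-1) ^+ k2 * (-1) ^+ k2) : R[i]).
      by rewrite -expr2 sqrr_sign mulr1.
    by rewrite mulrA -exprD ek exprD mulrAC.
  by rewrite -{1}(subnK lezn) exprD -!mulrA -expr2 sqrr_sign mulr1.
set P1 := qprod h (m1 + a1) z; set P2 := qprod h (m2 + a2) (n - z).
set P := qprod h (m + _) n.
have eE : qpow h (m2 ^+ 2 - a2 ^+ 2 - (m ^+ 2 - (a1 + a2) ^+ 2) - k1%:R)
          * qpow h (z%:R * (m + (a1 + a2) + 1))
  = qpow h (m1 * (m1 - 1) + m2 * (m2 - 1) - m * (m - 1) + 2 * a1 * a2)
    * qpow h (- (m1 ^+ 2 - a1 ^+ 2 - (m ^+ 2 - (a1 + a2) ^+ 2) - k2%:R))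
    * qpow h (- ((n - z)%:R * (m + (a1 + a2) + 1))).
  rewrite -!qpowD -e1 -e2 natrB // -en ea; congr qpow; ring.
have -> : qfact h z * qfact h (n - z) * qfact h (k1 - z) * qfact h (k2 - (n - z))
  = qfact h (n - z) * qfact h z * qfact h (k2 - (n - z)) * qfact h (k1 - z) by ring.
move: (qfact h (n - z) * _ * _ * _)^-1 (P^-1) => X Y.
by ring: eE eS.
Qed.

End Symbols3j.

(** * The quasi-R-matrix *)

Section Theta.
Context {R : realType}.
Variable h : R[i].
Implicit Types (x y m : R[i]) (n k M : nat).

Lemma ifact_opp x : ifact (- h) x = ifact h x.
Proof. by rewrite /ifact qfact_opp. Qed.

Lemma qprod_opp x n : qprod (- h) x n = qprod h x n.
Proof. by apply: eq_bigr => j _; rewrite qnum_opp. Qed.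

(** Equal to q^(n(n-1)/2) (q - q^-1)^n / [n]!. *)
Definition theta_coef n : R[i] :=
  \prod_(0 <= t < n) (qpow h t%:R * qstep h / qnum h t.+1%:R).

(* Lusztig's quasi-R-matrix sum_n c_n E^n (x) F^n, truncated at n < M; on vectors
   with bounded second index the truncation changes nothing. *)
Definition theta m1 m2 M (v : R[i] -> R[i] -> R[i]) a1 a2 : R[i] :=
  \sum_(0 <= n < M)
     theta_coef n * qprod h (m1 - a1) n * qprod h (m2 + a2) n
     * v (a1 - n%:R) (a2 + n%:R).

Lemma eq_theta m1 m2 M u v a1 a2 :
  (forall n, (n < M)%N -> u (a1 - n%:R) (a2 + n%:R) = v (a1 - n%:R) (a2 + n%:R)) ->
  theta m1 m2 M u a1 a2 = theta m1 m2 M v a1 a2.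
Proof. by move=> uv; apply: eq_big_nat => n /andP[_ /uv ->]. Qed.

Lemma thetaZ m1 m2 M c v a1 a2 :
  theta m1 m2 M (fun x y => c * v x y) a1 a2 = c * theta m1 m2 M v a1 a2.
Proof. by rewrite /theta big_distrr; apply: eq_bigr => n _ /=; ring. Qed.

Lemma theta_sum m1 m2 M (I : Type) (r : seq I) (c : I -> R[i]) v a1 a2 :
  theta m1 m2 M (fun x y => \sum_(i <- r) c i * v i x y) a1 a2
  = \sum_(i <- r) c i * theta m1 m2 M (v i) a1 a2.
Proof.
rewrite /theta; under eq_bigr do rewrite big_distrr /=.
rewrite exchange_big; apply: eq_bigr => i _; rewrite big_distrr.
by apply: eq_bigr => n _ /=; ring.
Qed.

Hypothesis nat_nz : forall n, qnum h n.+1%:R != 0.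

Lemma theta_coefS n :
  theta_coef n.+1 * qnum h n.+1%:R = theta_coef n * qpow h n%:R * qstep h.
Proof. by rewrite /theta_coef big_nat_recr //= -!mulrA mulVf // mulr1. Qed.

Lemma F2_opp m1 m2 v a1 a2 :
  F2 (- h) m1 m2 v a1 a2 =
  qnum h (m1 + a1 + 1) * v (a1 + 1) a2
  + qpow h (2 * a1) * qnum h (m2 + a2 + 1) * v a1 (a2 + 1).
Proof. by rewrite /F2 !qnum_opp qpow_opp opprK. Qed.

(* The last term is the error of the truncation. *)
Lemma theta_F2 m1 m2 M v a1 a2 :
  theta m1 m2 M.+1 (F2 h m1 m2 v) a1 a2
  = F2 (- h) m1 m2 (theta m1 m2 M.+1 v) a1 a2
    - theta_coef M * (qpow h (2 * a1) - qpow h (2 * M%:R - 2 * a1))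
      * qprod h (m1 - a1) M * qprod h (m2 + a2) M.+1
      * v (a1 - M%:R) (a2 + M%:R + 1).
Proof.
rewrite F2_opp; elim: M => [|M IHM].
  rewrite /theta !big_nat1 /F2 /theta_coef big_geq // !qprod0.
  rewrite !mul1r qprodS qprod0 mul1r !subr0 !addr0 mulr0 add0r.
  by ring.
rewrite /theta !(big_nat_recr M.+1) //= -!/(theta _ _ _ _ _ _) IHM {IHM}.
have -> : qprod h (m1 - (a1 + 1)) M.+1 = qnum h (m1 - a1) * qprod h (m1 - a1) M.
  by rewrite qprodSl; congr (qnum h _ * qprod h _ _); ring.
rewrite [qprod h (m2 + a2) M.+2]qprodSl [qprod h (m1 - a1) M.+1]qprodS.
have e2 : qprod h (m2 + a2) M.+1 * qnum h (m2 + a2 + M.+1%:R + 1)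
    = qnum h (m2 + a2 + 1) * qprod h (m2 + a2 + 1) M.+1.
  by rewrite -qprodSl [RHS]qprodS -[M.+2%:R]natr1 addrA.
rewrite /F2 -[M.+1%:R]natr1 in e2 *.
have -> : a1 - (M%:R + 1) + 1 = a1 - M%:R by ring.
have -> : a1 + 1 - (M%:R + 1) = a1 - M%:R by ring.
have -> : a2 + 1 + (M%:R + 1) = a2 + (M%:R + 1) + 1 by ring.
have -> : a2 + M%:R + 1 = a2 + (M%:R + 1) by ring.
have -> : m1 + (a1 - (M%:R + 1)) + 1 = m1 + a1 - M%:R by ring.
have -> : m2 + (a2 + 1) = m2 + a2 + 1 by ring.
have -> : m2 + (a2 + (M%:R + 1)) + 1 = m2 + a2 + (M%:R + 1) + 1 by ring.
have e1 : qnum h (m1 - a1 + (M%:R + 1)) * qnum h (m1 + a1 - M%:R)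
  = qnum h (m1 - a1) * qnum h (m1 + a1 + 1) + qnum h (M%:R + 1) * qnum h (2 * a1 - M%:R).
  have := qnumM nat_nz (m1 - a1) (- (m1 + a1 + 1)) (M%:R + 1).
  have -> : - (m1 + a1 + 1) + (M%:R + 1) = - (m1 + a1 - M%:R) by ring.
  have -> : m1 - a1 - (m1 + a1 + 1) + (M%:R + 1) = - (2 * a1 - M%:R) by ring.
  by rewrite !qnumN !mulrN -opprD => /oppr_inj.
have e3 := theta_coefS M; rewrite -natr1 in e3.
(* The recursion [theta_coefS] is made for this: it turns the commutator term [M+1][2 a1 - M] of the
   new summand into the previous truncation error, which cancels. *)
have e4 : qpow h M%:R * qstep h * qnum h (2 * a1 - M%:R)
   = qpow h (2 * a1) - qpow h (2 * M%:R - 2 * a1).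
  rewrite qnumE -mulrA (mulrC (qstep h)) divfK ?qstep_neq0 // mulrBr -!qpowD.
  by congr (qpow h _ - qpow h _); ring.
rewrite -e4.
have -> : - (2 * (a1 - (M%:R + 1))) = 2 * (M%:R + 1) - 2 * a1 by ring.
rewrite [theta_coef M * _]mulrA [theta_coef M * _]mulrA -e3.
move: (v _ (a2 + (M%:R + 1))) (v _ (a2 + (M%:R + 1) + 1)) => V1 V2.
by ring: e1 e2.
Qed.

Let theta_num n : R[i] := \prod_(0 <= t < n) (qpow h t%:R * qstep h).

Lemma theta_coefE n : theta_coef n = theta_num n / qfact h n.
Proof.
rewrite /theta_coef /theta_num /qfact big_split /=; congr (_ * _).
by rewrite -prodfV [RHS]big_add1.
Qed.

(** With Y = q^(-2(x+1)) this is Cauchy's identity: Y^j is the sum over n of the q^2-binomial of (j,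
    n) times the product of Y - q^(2t) over t < n. *)
Lemma qbinomial_theta j x :
  \sum_(0 <= n < j.+1) qbin h j n *
    ((-1) ^+ n * qpow h (j%:R * n%:R - n%:R ^+ 2 - n%:R * (x + 1))
     * theta_num n * qprod h x n)
  = qpow h (- (2 * j%:R * (x + 1))).
Proof.
elim: j => [|j IHj].
  rewrite big_nat1 qbinn0 /theta_num big_geq // qprod0 !mul1r !mulr1.
  by congr qpow; ring.
rewrite qbin_sum.
have -> : qpow h (- (2 * j.+1%:R * (x + 1)))
    = qpow h (- (2 * (x + 1))) * qpow h (- (2 * j%:R * (x + 1))).
  by rewrite -qpowD -natr1; congr qpow; ring.
rewrite -IHj big_distrr; apply: eq_big_nat => n /andP[_]; rewrite ltnS => lenj /=.
rewrite [RHS]mulrCA; congr (_ * _).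
rewrite qprodS /theta_num big_nat_recr //= -/(theta_num n) [(-1) ^+ n.+1]exprS natrB //.
rewrite -[j.+1%:R]natr1 -[n.+1%:R]natr1.
set P := qprod h x n; set T := theta_num n; set s := (-1) ^+ n.
set Q := qpow h (j%:R * n%:R - n%:R ^+ 2 - n%:R * (x + 1)).
have -> : qpow h ((j%:R + 1) * n%:R - n%:R ^+ 2 - n%:R * (x + 1)) = Q * qpow h n%:R.
  by rewrite -qpowD; congr qpow; ring.
have -> : qpow h ((j%:R + 1) * (n%:R + 1) - (n%:R + 1) ^+ 2 - (n%:R + 1) * (x + 1))
   = Q * qpow h (j%:R - n%:R - (x + 1)).
  by rewrite -qpowD; congr qpow; ring.
have e : qstep h * qnum h (x + (n%:R + 1))
   = qpow h (x + 1 + n%:R) - qpow h (- (x + 1 + n%:R)).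
  rewrite qnumE mulrC divfK ?qstep_neq0 //.
  by congr (qpow h _ - qpow h _); ring.
have e1 : qpow h (- (j%:R - n%:R)) * qpow h (j%:R - n%:R - (x + 1)) * qpow h n%:R
     * qpow h (x + 1 + n%:R) = qpow h n%:R * qpow h n%:R.
  by rewrite -!qpowD; congr qpow; ring.
have e2 : qpow h (- (j%:R - n%:R)) * qpow h (j%:R - n%:R - (x + 1)) * qpow h n%:R
     * qpow h (- (x + 1 + n%:R)) = qpow h (- (2 * (x + 1))).
  by rewrite -!qpowD; congr qpow; ring.
rewrite -e2.
transitivity (s * T * P * Q * (qpow h n%:R * qpow h n%:R
   - qpow h (- (j%:R - n%:R)) * qpow h (j%:R - n%:R - (x + 1)) * qpow h n%:R
     * (qstep h * qnum h (x + (n%:R + 1))))); first by ring.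
by rewrite e -e1; ring.
Qed.

(** Common template of the two evaluations of [theta]: x is m2 + a2 for a highest weight vector of
    two factors and 2 m23 - j for e^(m23). *)
Lemma theta_eval m1 m2 M j c x v a1 a2 : (j <= M)%N ->
  (forall n, (n <= j)%N ->
     qprod h (m1 - a1) n * qprod h (m2 + a2) n * v (a1 - n%:R) (a2 + n%:R)
     = c * ((-1) ^+ n * qpow h (j%:R * n%:R - n%:R ^+ 2 - n%:R * (x + 1))
            * (qfact h j / qfact h (j - n)) * qprod h x n)) ->
  (forall n, (j < n)%N -> v (a1 - n%:R) (a2 + n%:R) = 0) ->
  theta m1 m2 M.+1 v a1 a2 = c * qpow h (- (2 * j%:R * (x + 1))).
Proof.
move=> lejM vE v0; rewrite /theta (big_cat_nat (n := j.+1)) //=.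
rewrite [X in _ + X]big_nat_cond [X in _ + X]big1 ?addr0; last first.
  by move=> n /andP[/andP[ltjn _] _]; rewrite v0 ?mulr0.
rewrite -qbinomial_theta big_distrr; apply: eq_big_nat => n /andP[_].
rewrite ltnS => lenj /=; rewrite -2!mulrA [X in _ * X]mulrA vE // theta_coefE qbinE //.
rewrite !invfM; by ring.
Qed.

(** The hypothesis makes the truncation harmless: for n > M the index a2 + n lies outside M_m2. The
    value q^(-2j(m2+a2+1)) of the q-binomial sum inverts the quadratic power of q in [hwvec], up to
    the scalar. *)
Lemma theta_hwvec m1 m2 m M a1 a2 : ~~ is_natC (m2 - a2 - M.+1%:R) ->
  theta m1 m2 M.+1 (hwvec h m1 m2 m) a1 a2
  = qpow h (- (2 * (m1 + m2 - m))) * hwvec (- h) m1 m2 m a1 a2.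
Proof.
move=> Mbig; have [ea|aN] := eqVneq (a1 + a2) m; last first.
  rewrite {2}/hwvec (negbTE aN) mulr0 /theta big1 // => n _.
  rewrite /hwvec ifN ?mulr0 //; apply: contra aN => /eqP <-; apply/eqP.
  by ring.
have sumE n : a1 - n%:R + (a2 + n%:R) = m by rewrite -ea; ring.
have [/is_natCP[j ej]|jN] := boolP (is_natC (m2 - a2)); last first.
  rewrite {2}/hwvec ea eqxx {2}/ifact (negbTE jN) !mulr0 /theta big1 // => n _.
  rewrite /hwvec sumE eqxx {2}/ifact ifN ?mulr0 //.
  by apply: contra jN; rewrite opprD addrA => /is_natCB.
move: Mbig; rewrite ej is_natCBnat -leqNgt => lejM.
have ifE n : ifact h (m2 - (a2 + n%:R)) = ifact h (j%:R - n%:R).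
  by rewrite -ej; congr ifact; ring.
rewrite (@theta_eval m1 m2 M j (m1pow (m1 - a1) * qpow h (m2 ^+ 2 - a2 ^+ 2 - (m1 - a1))
    * ifact h (m1 - a1) / qfact h j) (m2 + a2)) //.
- rewrite /hwvec ea eqxx !ifact_opp ej qpow_opp.
  have -> : ifact h j%:R = (qfact h j)^-1 by rewrite -(subr0 j%:R) (ifact_natB h j 0) subn0.
  have e : qpow h (m2 ^+ 2 - a2 ^+ 2 - (m1 - a1)) * qpow h (- (2 * j%:R * (m2 + a2 + 1)))
    = qpow h (- (2 * (m1 + m2 - m))) * qpow h (- (m2 ^+ 2 - a2 ^+ 2 - (m1 - a1))).
    by rewrite -!qpowD -ea -ej; congr qpow; ring.
  move: (qfact h j)^-1 => X; by ring: e.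
- move=> n lenj; rewrite /hwvec sumE eqxx ifE ifact_natB lenj.
  have -> : m1 - (a1 - n%:R) = m1 - a1 + n%:R by ring.
  rewrite -(qprod_ifact nat_nz (m1 - a1) n) m1powD m1pow_nat.
  have -> : qpow h (m2 ^+ 2 - (a2 + n%:R) ^+ 2 - (m1 - a1 + n%:R))
     = qpow h (m2 ^+ 2 - a2 ^+ 2 - (m1 - a1))
       * qpow h (j%:R * n%:R - n%:R ^+ 2 - n%:R * (m2 + a2 + 1)).
    by rewrite -!qpowD -ej; congr qpow; ring.
  have e : qfact h j / qfact h j = 1 by rewrite divff ?qfact_neq0.
  move: (qfact h j)^-1 (qfact h (j - n))^-1 e => X Y e.
  by ring: e.
- by move=> n ltjn; rewrite /hwvec sumE eqxx ifE ifact_natB leqNgt ltjn mulr0.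
Qed.

Lemma theta_iter_F2 m1 m2 m n M a1 a2 : ~~ is_natC (m2 - a2 - M.+1%:R) ->
  theta m1 m2 M.+1 (iter n (F2 h m1 m2) (hwvec h m1 m2 m)) a1 a2
  = qpow h (- (2 * (m1 + m2 - m)))
    * iter n (F2 (- h) m1 m2) (hwvec (- h) m1 m2 m) a1 a2.
Proof.
elim: n a1 a2 => [|n IHn] a1 a2 Mbig; first exact: theta_hwvec.
rewrite !iterS theta_F2 !F2_opp !IHn //; last first.
  apply: contra Mbig => /(is_natCD 1).
  by rewrite (_ : _ + 1%:R = m2 - a2 - M.+1%:R) //; ring.
(* The truncation error reads the vector at second index a2 + M + 1, outside its support by
   [Mbig]. *)
rewrite [iter n (F2 h m1 m2) _ (a1 - _) _](_ : _ = 0); last first.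
  apply: contraNeq Mbig => /iter_F2_supp[_ _].
  by rewrite -addrA natr1 opprD addrA.
by rewrite mulr0 subr0; ring.
Qed.

End Theta.

(** * The quasi-R-matrix on the coupled vectors *)

Local Opaque qpow m1pow qnum.

Section Theta3j.
Context {R : realType}.
Variables (h : R[i]) (D : R[i] -> R[i] -> R[i] -> R[i]).
Hypothesis nat_nz : forall n, qnum h n.+1%:R != 0.
Implicit Types (x y m a : R[i]) (n k : nat).

Lemma q3j_hw m1 m2 m a1 a2 : is_natC (m1 + m2 - m) ->
  q3j h D m1 m2 m a1 a2 m = q3j_scale D m1 m2 m * hwvec h m1 m2 m a1 a2.
Proof.
by move=> Jn; have := q3jE D nat_nz 0 a1 a2 Jn; rewrite subr0 qprod0 divr1.
Qed.

Lemma q3j_hw_neq0 m1 m2 m a1 a2 : is_natC (m1 - a1) -> is_natC (m2 - a2) ->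
  a1 + a2 = m -> D m1 m2 m != 0 -> q3j h D m1 m2 m a1 a2 m != 0.
Proof.
move=> n1 n2 em D0.
have Jn : is_natC (m1 + m2 - m).
  case/is_natCP: n1 n2 => [k1 e1] /is_natCP[k2 e2].
  have -> : m1 + m2 - m = k1%:R + k2%:R by rewrite -e1 -e2 -em; ring.
  by rewrite -natrD is_natC_nat.
rewrite q3j_hw // /q3j_scale /hwvec em eqxx /ifact n1 n2.
apply: mulf_neq0; first by apply: mulf_neq0 => //; exact: m1pow_neq0.
apply: mulf_neq0; last exact/invr_neq0/qfact_neq0.
apply: mulf_neq0; last exact/invr_neq0/qfact_neq0.
by apply: mulf_neq0; [exact: m1pow_neq0 | exact: qpow_neq0].
Qed.

(* With the second index at its highest weight only one term of the defining
   sum survives. *)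
Lemma q3j_top2 m1 m2 m j a1 : is_natC (m1 + m2 - m) -> a1 + m2 = m - j%:R ->
  q3j h D m1 m2 m a1 m2 (m - j%:R)
  = q3j_scale D m1 m2 m
    * (m1pow (m1 + m2 - m) * qpow h (- (m1 + m2 - m)) * ifact h (m1 + m2 - m))
    * (qprod h (m1 + a1) j / qprod h (2 * m - j%:R) j).
Proof.
move=> Jn ea; rewrite q3jE // iter_F2 big_nat_recr //= big_nat_cond big1 ?add0r.
  rewrite subnn qbinE // subnn qfact0 mulr1 divff ?qfact_neq0 // !mul0r oppr0 qpow0.
  rewrite qprod0 addr0 mul1r mulr1 mul1r /hwvec.
  have -> : a1 + j%:R + m2 = m by rewrite addrAC ea subrK.
  rewrite eqxx !subrr.
  have -> : m1 - (a1 + j%:R) = m1 + m2 - m.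
    have -> : m = a1 + m2 + j%:R by rewrite ea subrK.
    by ring.
  have -> : ifact h 0 = 1 by rewrite -(subrr 0%:R) (ifact_natB h 0 0) qfact0 invr1.
  by rewrite add0r; ring.
move=> z /andP[/andP[_ ltzj] _]; rewrite /hwvec.
have -> : m2 - (m2 + (j - z)%:R) = 0%:R - (j - z)%:R by rewrite opprD addrA subrr.
rewrite ifact_natB leqn0 subn_eq0 leqNgt ltzj /=.
by case: ifP; rewrite !mulr0.
Qed.

Lemma theta_q3j m1 m2 m n M a1 a2 : ~~ is_natC (m2 - a2 - M.+1%:R) ->
  theta h m1 m2 M.+1 (fun x y => q3j h D m1 m2 m x y (m - n%:R)) a1 a2
  = qpow h (- (2 * (m1 + m2 - m))) * q3j (- h) D m1 m2 m a1 a2 (m - n%:R).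
Proof.
move=> Mbig; have [Jn|JN] := boolP (is_natC (m1 + m2 - m)); last first.
  have z g x y b : q3j g D m1 m2 m x y b = 0 by apply: contraNeq JN => /q3j_supp[].
  by rewrite z mulr0 /theta big1 // => k _; rewrite z mulr0.
have nat_nz' k : qnum (- h) k.+1%:R != 0 by rewrite qnum_opp.
rewrite q3jE // qprod_opp mulrCA -(theta_iter_F2 nat_nz m1 m n a1 Mbig) -thetaZ.
by apply: eq_theta => k _; rewrite q3jE.
Qed.

Section Triple.
Variables m1 m2 m3 m : R[i].

Lemma evec12E m12 a a1 a2 a3 :
  evec12 h D m1 m2 m3 m12 m a a1 a2 a3
  = q3j h D m12 m3 m (a1 + a2) a3 a * q3j h D m1 m2 m12 a1 a2 (a1 + a2).
Proof.
rewrite /evec12; case: eqP => // ne; rewrite [q3j h D m12 _ _ _ _ _](_ : _ = 0) ?mul0r //.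
by apply/eqP; apply: contra_notT ne => /q3j_supp[_ _ _ _ ->].
Qed.

Lemma evec23E m23 a a1 a2 a3 :
  evec23 h D m1 m2 m3 m23 m a a1 a2 a3
  = q3j h D m1 m23 m a1 (a2 + a3) a * q3j h D m2 m3 m23 a2 a3 (a2 + a3).
Proof.
rewrite /evec23; case: eqP => // ne; rewrite [q3j h D m1 _ _ _ _ _](_ : _ = 0) ?mul0r //.
by apply/eqP; apply: contra_notT ne => /q3j_supp[_ _ _ _ ->]; rewrite addrA.
Qed.

Lemma evec12_supp m12 a a1 a2 a3 : evec12 h D m1 m2 m3 m12 m a a1 a2 a3 != 0 ->
  [/\ is_natC (m1 - a1), is_natC (m2 - a2), is_natC (m3 - a3) & a1 + a2 + a3 = a].
Proof.
rewrite evec12E mulf_eq0 negb_or => /andP[/q3j_supp[_ _ n3 _ ->] /q3j_supp[_ n1 n2 _ _]].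
by [].
Qed.

Lemma evec23_supp m23 a a1 a2 a3 : evec23 h D m1 m2 m3 m23 m a a1 a2 a3 != 0 ->
  [/\ is_natC (m1 - a1), is_natC (m2 - a2), is_natC (m3 - a3) & a1 + a2 + a3 = a].
Proof.
rewrite evec23E mulf_eq0 negb_or => /andP[/q3j_supp[_ n1 _ _ ->] /q3j_supp[_ n2 n3 _ _]].
by rewrite addrA.
Qed.

End Triple.
End Theta3j.

Section ThetaTriple.
Context {R : realType}.
Variables (h : R[i]) (D : R[i] -> R[i] -> R[i] -> R[i]).
Hypothesis nat_nz : forall n, qnum h n.+1%:R != 0.
Variables (m1 m2 m3 m : R[i]).
Implicit Types (x y a : R[i]) (n k : nat).

(** [theta] keeps a1 + a2, so the outer 3j-symbol is a constant for it. On the slice that symbol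
    depends on q only through q^(-n), n = m12 + m3 - m, and passing to q^-1 costs q^(-2n), which
    completes the inner scalar q^(-2(m1+m2-m12)). *)
Lemma theta_evec12 m12 M a1 a2 : a1 + a2 + m3 = m ->
  ~~ is_natC (m2 - a2 - M.+1%:R) ->
  theta h m1 m2 M.+1 (fun x y => evec12 h D m1 m2 m3 m12 m m x y m3) a1 a2
  = qpow h (- (2 * (m1 + m2 + m3 - m)))
    * evec12 (- h) D m1 m2 m3 m12 m m a1 a2 m3.
Proof.
move=> ea Mbig; rewrite evec12E.
have sumE n : a1 - n%:R + (a2 + n%:R) = a1 + a2 by ring.
transitivity (theta h m1 m2 M.+1
    (fun x y => q3j h D m12 m3 m (a1 + a2) m3 m * q3j h D m1 m2 m12 x y (a1 + a2)) a1 a2).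
  by apply: eq_theta => n _; rewrite evec12E sumE.
rewrite thetaZ.
have [/is_natCP[n en]|nN] := boolP (is_natC (m12 - (a1 + a2))); last first.
  by rewrite !(q3j_eq0' _ _ _ _ _ _ nN) !mul0r mulr0.
have -> : a1 + a2 = m12 - n%:R by rewrite -en; ring.
rewrite theta_q3j //.
have nat_nz' k : qnum (- h) k.+1%:R != 0 by rewrite qnum_opp.
have Jn : is_natC (m12 + m3 - m).
  apply/is_natCP; exists n; rewrite -en -ea; ring.
rewrite !q3j_hw // /hwvec !ifact_opp.
have -> : m12 - n%:R + m3 = m by rewrite -en -ea; ring.
rewrite eqxx qpow_opp !subrr.
have -> : m12 - (m12 - n%:R) = n%:R by ring.
have e : qpow h (0 - n%:R) * qpow h (- (2 * (m1 + m2 - m12)))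
  = qpow h (- (2 * (m1 + m2 + m3 - m))) * qpow h (- (0 - n%:R)).
  rewrite -!qpowD; congr qpow; rewrite -ea.
  have -> : m12 = a1 + a2 + n%:R by rewrite -en; ring.
  by ring.
by ring: e.
Qed.

(** Here [theta] moves the indices of both symbols. On the slice the outer one is at its highest
    weight and the inner one has its second index on top, so their product has the shape required by
    [theta_eval]. *)
Lemma theta_evec23 m23 M a1 a2 :
  (forall n, qnum h (2 * m23 - n%:R) != 0) ->
  is_natC (m2 + m3 - m23) -> is_natC (m1 + m23 - m) ->
  a1 + a2 + m3 = m -> ~~ is_natC (m2 - a2 - M.+1%:R) ->
  theta h m1 m2 M.+1 (fun x y => evec23 h D m1 m2 m3 m23 m m x y m3) a1 a2
  = qpow h (- (2 * (m1 + m2 + m3 - m)))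
    * evec23 (- h) D m1 m2 m3 m23 m m a1 a2 m3.
Proof.
move=> reg J2 J1 ea Mbig; rewrite evec23E.
have nat_nz' k : qnum (- h) k.+1%:R != 0 by rewrite qnum_opp.
have sumE n : a1 - n%:R + (a2 + n%:R) + m3 = m by rewrite -ea; ring.
have [/is_natCP[j ej]|jN] := boolP (is_natC (m23 - (a2 + m3))); last first.
  rewrite (q3j_eq0 _ _ _ _ _ _ jN) !mulr0 /theta big1 // => n _.
  rewrite evec23E [q3j h D m2 _ _ _ _ _]q3j_eq0 ?mulr0 //; apply: contra jN.
  have -> : m23 - (a2 + n%:R + m3) = m23 - (a2 + m3) - n%:R by ring.
  exact: is_natCB.
have bE : a2 + m3 = m23 - j%:R by rewrite -ej; ring.
have lejM : (j <= M)%N.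
  rewrite leqNgt; apply: contra Mbig => ltMj; case/is_natCP: J2 => J eJ.
  have -> : m2 - a2 - M.+1%:R = (J + j)%:R - M.+1%:R.
    by rewrite natrD -eJ -ej; ring.
  by rewrite is_natCBnat (leq_trans ltMj) // leq_addl.
have Px : qprod h (2 * m23 - j%:R) j != 0.
  apply: qprod_neq0 => k /andP[_ lekj].
  have -> : 2 * m23 - j%:R + k%:R = 2 * m23 - (j - k)%:R by rewrite natrB //; ring.
  exact: reg.
pose A := q3j_scale D m1 m23 m * q3j_scale D m2 m3 m23
    * (m1pow (m2 + m3 - m23) * ifact h (m2 + m3 - m23)) * m1pow (m1 - a1)
    * (qprod h (m2 + a2) j / qprod h (2 * m23 - j%:R) j) * ifact h (m1 - a1) / qfact h j.
pose e := m23 ^+ 2 - (m23 - j%:R) ^+ 2 - (m1 - a1) - (m2 + m3 - m23).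
have ajm : a1 + (m23 - j%:R) = m by rewrite -bE addrA.
have ifj : ifact h j%:R = (qfact h j)^-1 by rewrite -(subr0 j%:R) (ifact_natB h j 0) subn0.
(* [A] gathers the factors even in h and [e] the exponent of q, so one computation covers q and
   q^-1. *)
have e23 g : g = h \/ g = - h ->
  q3j g D m1 m23 m a1 (a2 + m3) m * q3j g D m2 m3 m23 a2 m3 (a2 + m3)
  = A * qpow g e.
  move=> gh; have gz k : qnum g k.+1%:R != 0 by case: gh => ->.
  have gif x : ifact g x = ifact h x by case: gh => -> //; rewrite ifact_opp.
  have gpr x n : qprod g x n = qprod h x n by case: gh => -> //; rewrite qprod_opp.
  rewrite bE q3j_hw // q3j_top2 // /hwvec ajm eqxx !gif !gpr.
  have -> : m23 - (m23 - j%:R) = j%:R by ring.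
  by rewrite ifj /A /e [qpow g (_ - (m2 + m3 - m23))]qpowD; ring.
rewrite e23; last by right.
rewrite (@theta_eval _ h nat_nz m1 m2 M j (A * qpow h e) (2 * m23 - j%:R)) //.
- have -> : qpow (- h) e = qpow h (- e) by rewrite qpow_opp.
  rewrite -[LHS]mulrA -qpowD [RHS]mulrCA -qpowD; congr (_ * qpow h _).
  have -> : m2 = a2 + m3 + (m2 - a2 - m3) by ring.
  rewrite /e -ea.
  have -> : m23 = a2 + m3 + j%:R by rewrite -ej; ring.
  by ring.
- move=> n lenj; rewrite evec23E.
  have -> : a2 + n%:R + m3 = m23 - (j - n)%:R by rewrite natrB // -ej; ring.
  have ajm' : a1 - n%:R + (m23 - (j - n)%:R) = m by rewrite -ajm natrB //; ring.
  rewrite q3j_hw // q3j_top2 //; last by rewrite natrB // -ej; ring.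
  rewrite /hwvec ajm' eqxx.
  have -> : m23 - (m23 - (j - n)%:R) = j%:R - n%:R by rewrite natrB //; ring.
  rewrite ifact_natB lenj.
  have -> : m1 - (a1 - n%:R) = m1 - a1 + n%:R by ring.
  have eP : qprod h (m2 + a2) n * qprod h (m2 + (a2 + n%:R)) (j - n) = qprod h (m2 + a2) j.
    by rewrite addrA -qprodD subnKC.
  (* The normalising denominator of the inner symbol supplies the numerator [qprod h x n] with x = 2
     m23 - j. *)
  have eX : (qprod h (2 * m23 - (j - n)%:R) (j - n))^-1
     = qprod h (2 * m23 - j%:R) n / qprod h (2 * m23 - j%:R) j.
    have e0 : qprod h (2 * m23 - j%:R) j
        = qprod h (2 * m23 - j%:R) n * qprod h (2 * m23 - (j - n)%:R) (j - n).
      have -> : 2 * m23 - (j - n)%:R = 2 * m23 - j%:R + n%:R by rewrite natrB //; ring.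
      by rewrite -qprodD subnKC.
    rewrite e0 invfM mulrA mulfV ?mul1r //.
    by apply: contraNneq Px => z; rewrite e0 z mul0r.
  rewrite eX /A -(qprod_ifact nat_nz (m1 - a1) n) -eP m1powD m1pow_nat.
  have eq : qpow h (m23 ^+ 2 - (m23 - (j - n)%:R) ^+ 2 - (m1 - a1 + n%:R))
       * qpow h (- (m2 + m3 - m23))
     = qpow h e * qpow h (j%:R * n%:R - n%:R ^+ 2 - n%:R * (2 * m23 - j%:R + 1)).
    by rewrite -!qpowD natrB // /e; congr qpow; ring.
  have ef : qfact h j / qfact h j = 1 by rewrite divff ?qfact_neq0.
  move: (qfact h j)^-1 (qfact h (j - n))^-1 ef => X Y ef.
  move: (qprod h (2 * m23 - j%:R) j)^-1 => Z.
  by ring: eq ef.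
- move=> n ltjn; rewrite evec23E [q3j h D m2 _ _ _ _ _]q3j_eq0 ?mulr0 //.
  have -> : m23 - (a2 + n%:R + m3) = j%:R - n%:R by rewrite -ej; ring.
  by rewrite is_natCBnat -ltnNge.
Qed.

End ThetaTriple.

(** * Triple tensor products *)

Section TripleOperators.
Context {R : realType}.
Variables (h : R[i]) (D : R[i] -> R[i] -> R[i] -> R[i]).
Variables (m1 m2 m3 m : R[i]).
Implicit Types (x y a : R[i]) (n k : nat) (v : R[i] -> R[i] -> R[i] -> R[i]).

Definition E3 v a1 a2 a3 : R[i] :=
  qpow h (2 * (a2 + a3)) * qnum h (m1 - a1 + 1) * v (a1 - 1) a2 a3
  + qpow h (2 * a3) * qnum h (m2 - a2 + 1) * v a1 (a2 - 1) a3
  + qnum h (m3 - a3 + 1) * v a1 a2 (a3 - 1).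

Definition F3 v a1 a2 a3 : R[i] :=
  qnum h (m1 + a1 + 1) * v (a1 + 1) a2 a3
  + qpow h (- (2 * a1)) * qnum h (m2 + a2 + 1) * v a1 (a2 + 1) a3
  + qpow h (- (2 * (a1 + a2))) * qnum h (m3 + a3 + 1) * v a1 a2 (a3 + 1).

Lemma E3_sum (I : Type) (r : seq I) (c : I -> R[i])
    (v : I -> R[i] -> R[i] -> R[i] -> R[i]) a1 a2 a3 :
  E3 (fun x y z => \sum_(i <- r) c i * v i x y z) a1 a2 a3
  = \sum_(i <- r) c i * E3 (v i) a1 a2 a3.
Proof.
rewrite /E3 !big_distrr -!big_split; apply: eq_bigr => i _ /=; ring.
Qed.

Lemma F3_sum (I : Type) (r : seq I) (c : I -> R[i])
    (v : I -> R[i] -> R[i] -> R[i] -> R[i]) a1 a2 a3 :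
  F3 (fun x y z => \sum_(i <- r) c i * v i x y z) a1 a2 a3
  = \sum_(i <- r) c i * F3 (v i) a1 a2 a3.
Proof.
rewrite /F3 !big_distrr -!big_split; apply: eq_bigr => i _ /=; ring.
Qed.

Hypothesis nat_nz : forall n, qnum h n.+1%:R != 0.

(* E3 u determines u at height k + 1 in the third factor from its values at
   height k. *)
Lemma E3_inj u v :
  (forall a1 a2 a3, ~~ is_natC (m3 - a3) -> u a1 a2 a3 = v a1 a2 a3) ->
  (forall a1 a2 a3, E3 u a1 a2 a3 = E3 v a1 a2 a3) ->
  (forall a1 a2, u a1 a2 m3 = v a1 a2 m3) ->
  forall a1 a2 a3, u a1 a2 a3 = v a1 a2 a3.
Proof.
move=> supp eqE top a1 a2 a3.
have [/is_natCP[k ek]|/supp//] := boolP (is_natC (m3 - a3)).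
have -> : a3 = m3 - k%:R by rewrite -ek; ring.
elim: k {a3 ek} a1 a2 => [|k IHk] a1 a2; first by rewrite subr0.
have := eqE a1 a2 (m3 - k%:R); rewrite /E3 !IHk => /addrI.
have -> : m3 - (m3 - k%:R) + 1 = k.+1%:R by rewrite -natr1; ring.
have -> : m3 - k%:R - 1 = m3 - k.+1%:R by rewrite -natr1; ring.
exact: mulfI.
Qed.

Hypothesis reg : forall n, qnum h (2 * m - n%:R) != 0.

(** Coassociativity: the first two terms of [E3] are the coproduct of E on the inner symbol, which
    turns them into the first term of the coproduct on the outer one. *)
Lemma E3_evec12 m12 a a1 a2 a3 : (forall n, qnum h (2 * m12 - n%:R) != 0) ->
  E3 (evec12 h D m1 m2 m3 m12 m a) a1 a2 a3
  = qnum h (m - a) * evec12 h D m1 m2 m3 m12 m (a + 1) a1 a2 a3.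
Proof.
move=> reg12; rewrite /E3 !evec12E.
have -> : a1 - 1 + a2 = a1 + a2 - 1 by ring.
have -> : a1 + (a2 - 1) = a1 + a2 - 1 by ring.
have := E2_q3j D nat_nz m1 m2 (a1 + a2 - 1) a1 a2 reg12.
have := E2_q3j D nat_nz m12 m3 a (a1 + a2) a3 reg.
rewrite /E2 subrK.
have -> : m12 - (a1 + a2 - 1) = m12 - (a1 + a2) + 1 by ring.
have -> : 2 * (a2 + a3) = 2 * a2 + 2 * a3 by ring.
rewrite qpowD => e1 e2; rewrite [RHS]mulrA -e1 [RHS]mulrDl.
rewrite [X in _ = X + _](_ : _ = qpow h (2 * a3) *
  q3j h D m12 m3 m (a1 + a2 - 1) a3 a
  * (qnum h (m12 - (a1 + a2) + 1) * q3j h D m1 m2 m12 a1 a2 (a1 + a2))); last by ring.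
by rewrite -e2; ring.
Qed.

Lemma E3_evec23 m23 a a1 a2 a3 : (forall n, qnum h (2 * m23 - n%:R) != 0) ->
  E3 (evec23 h D m1 m2 m3 m23 m a) a1 a2 a3
  = qnum h (m - a) * evec23 h D m1 m2 m3 m23 m (a + 1) a1 a2 a3.
Proof.
move=> reg23; rewrite /E3 !evec23E.
have -> : a2 - 1 + a3 = a2 + a3 - 1 by ring.
have -> : a2 + (a3 - 1) = a2 + a3 - 1 by ring.
have := E2_q3j D nat_nz m2 m3 (a2 + a3 - 1) a2 a3 reg23.
have := E2_q3j D nat_nz m1 m23 a a1 (a2 + a3) reg.
rewrite /E2 subrK.
have -> : m23 - (a2 + a3 - 1) = m23 - (a2 + a3) + 1 by ring.
move=> e1 e2; rewrite [RHS]mulrA -e1 [RHS]mulrDl [X in _ = _ + X](_ : _ =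
  q3j h D m1 m23 m a1 (a2 + a3 - 1) a
  * (qnum h (m23 - (a2 + a3) + 1) * q3j h D m2 m3 m23 a2 a3 (a2 + a3))); last by ring.
by rewrite -e2; ring.
Qed.

Lemma F3_evec12 m12 a a1 a2 a3 : (forall n, qnum h (2 * m12 - n%:R) != 0) ->
  is_natC (m - a) ->
  F3 (evec12 h D m1 m2 m3 m12 m a) a1 a2 a3
  = qnum h (m + a) * evec12 h D m1 m2 m3 m12 m (a - 1) a1 a2 a3.
Proof.
move=> reg12 an; rewrite /F3 !evec12E.
have -> : a1 + 1 + a2 = a1 + a2 + 1 by ring.
have -> : a1 + (a2 + 1) = a1 + a2 + 1 by ring.
have := F2_q3j D nat_nz m12 m3 (a1 + a2) a3 reg an.
rewrite /F2 => e1; rewrite [RHS]mulrA -e1 [RHS]mulrDl.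
(* [F2_q3j] for the inner symbol needs this naturality; without it the outer symbol at a1 + a2 + 1
   vanishes. *)
have [n1|N1] := boolP (is_natC (m12 - (a1 + a2 + 1))); last first.
  by rewrite !(q3j_eq0' _ _ _ _ _ _ N1) !(mulr0, mul0r, add0r); ring.
have := F2_q3j D nat_nz m1 m2 a1 a2 reg12 n1.
rewrite /F2 addrK addrA => e2.
rewrite [X in _ = X + _](_ : _ =
  q3j h D m12 m3 m (a1 + a2 + 1) a3 a
  * (qnum h (m12 + (a1 + a2) + 1) * q3j h D m1 m2 m12 a1 a2 (a1 + a2))); last by ring.
by rewrite -e2; ring.
Qed.

Lemma F3_evec23 m23 a a1 a2 a3 : (forall n, qnum h (2 * m23 - n%:R) != 0) ->
  is_natC (m - a) ->
  F3 (evec23 h D m1 m2 m3 m23 m a) a1 a2 a3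
  = qnum h (m + a) * evec23 h D m1 m2 m3 m23 m (a - 1) a1 a2 a3.
Proof.
move=> reg23 an; rewrite /F3 !evec23E.
have -> : a2 + 1 + a3 = a2 + a3 + 1 by ring.
have -> : a2 + (a3 + 1) = a2 + a3 + 1 by ring.
have := F2_q3j D nat_nz m1 m23 a1 (a2 + a3) reg an.
rewrite /F2 => e1; rewrite [RHS]mulrA -e1 [RHS]mulrDl.
have -> : - (2 * (a1 + a2)) = - (2 * a1) + - (2 * a2) by ring.
rewrite qpowD.
have [n1|N1] := boolP (is_natC (m23 - (a2 + a3 + 1))); last first.
  have z : q3j h D m1 m23 m a1 (a2 + a3 + 1) a = 0.
    by apply: contraNeq N1 => /q3j_supp[].
  by rewrite !z !(mulr0, mul0r, addr0); ring.
have := F2_q3j D nat_nz m2 m3 a2 a3 reg23 n1.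
rewrite /F2 addrK addrA => e2.
rewrite [X in _ = _ + X](_ : _ = qpow h (- (2 * a1)) *
  q3j h D m1 m23 m a1 (a2 + a3 + 1) a
  * (qnum h (m23 + (a2 + a3) + 1) * q3j h D m2 m3 m23 a2 a3 (a2 + a3))); last by ring.
by rewrite -e2; ring.
Qed.

End TripleOperators.

(** * Existence of the 6j-symbols *)

Section Triangular.
Context {F : fieldType}.
Variables (N : nat) (T : nat -> nat -> F).
Hypothesis T_lower : forall j k, (j < k)%N -> T j k = 0.
Hypothesis T_diag : forall j, (j <= N)%N -> T j j != 0.

Let M : 'M[F]_N.+1 := \matrix_(i, j) T i j.

Let M_unit : M \in unitmx.
Proof.
rewrite unitmxE det_trig; last first.
  by apply/is_trig_mxP => i j ltij; rewrite mxE T_lower.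
rewrite unitfE; apply/prodf_neq0 => i _; rewrite mxE T_diag //.
by rewrite -ltnS.
Qed.

Lemma triangular_solve (b : nat -> F) :
  {c : nat -> F | forall j, (j <= N)%N -> b j = \sum_(0 <= k < N.+1) c k * T j k}.
Proof.
pose c : 'cV_N.+1 := invmx M *m (\col_i b i).
exists (fun k => c (inord k) 0) => j lejN.
have := mulKVmx M_unit (\col_i b i); rewrite -/c => /matrixP/(_ (inord j) 0).
rewrite !mxE inordK // => <-; rewrite big_mkord; apply: eq_bigr => i _.
by rewrite !mxE inordK // inord_val mulrC.
Qed.

Lemma triangular_inj (b c : nat -> F) :
  (forall j, (j <= N)%N ->
     \sum_(0 <= k < N.+1) b k * T j k = \sum_(0 <= k < N.+1) c k * T j k) ->
  forall k, (k <= N)%N -> b k = c k.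
Proof.
move=> bc k lekN.
have e : M *m (\col_i b i) = M *m (\col_i c i).
  apply/matrixP => i z; rewrite !mxE.
  have := bc i (ltn_ord i); rewrite !big_mkord => e.
  transitivity (\sum_(k < N.+1) b k * T i k).
    by apply: eq_bigr => l _; rewrite !mxE mulrC.
  by rewrite e; apply: eq_bigr => l _; rewrite !mxE mulrC.
have := mulKmx M_unit (\col_i b i); rewrite e mulKmx // => /matrixP/(_ (inord k) 0).
by rewrite !mxE inordK.
Qed.

End Triangular.

(** * Regular weights and the nonvanishing of Delta *)

Section Regular.
Local Open Scope classical_set_scope.
Context {R : realType}.
Implicit Types (h x y m : R[i]) (n k N J : nat).

(** Together with [n+1] <> 0 this is irreducibility of M_x, in view of [E2_iter_F2]. It is inherited
    by x - k, hence by the intermediate weights. *)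
Definition regular h x := forall n, qnum h (2 * x - n%:R) != 0.

Lemma regularB h x k : regular h x -> regular h (x - k%:R).
Proof.
move=> rx n; have -> : 2 * (x - k%:R) - n%:R = 2 * x - (k + k + n)%:R.
  by rewrite !natrD; ring.
exact: rx.
Qed.

Lemma Delta_root_regular h D m1 m2 J :
  Delta_root h D -> (forall n, qnum h n.+1%:R != 0) ->
  regular h m1 -> regular h m2 -> regular h (m1 + m2) ->
  D m1 m2 (m1 + m2 - J%:R) != 0
  /\ D m1 m2 (m1 + m2 - J%:R) = D m2 m1 (m1 + m2 - J%:R).
Proof.
move=> hD nat_nz r1 r2 r12.
have nz j : (j < J)%N -> qnum h (2 * (m1 + m2 - J%:R) + 2 + j%:R) != 0.
  move=> ltjJ.
  (* Natural subtrahend 2J - 2 - j, thanks to j < J. *)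
  have -> : 2 * (m1 + m2 - J%:R) + 2 + j%:R
      = 2 * (m1 + m2) - (J.-1 + (J - j.+1))%:R.
    case: J ltjJ => // J ltjJ; rewrite natrD subSS natrB //= -natr1; ring.
  exact: r12.
have [sq sym] := hD m1 m2 J nz; split=> //.
suff : D m1 m2 (m1 + m2 - J%:R) ^+ 2 != 0 by rewrite expf_eq0.
rewrite sq; apply: mulf_neq0; first exact: qfact_neq0.
rewrite prodf_seq_neq0; apply/allP => j; rewrite mem_index_iota => /andP[_ ltjJ] /=.
apply: mulf_neq0; last by apply: invr_neq0; exact: nz.
by apply: mulf_neq0; [exact: r1 | exact: r2].
Qed.

Lemma adm23_sum m1 m2 m3 m N (f : R[i] -> R[i]) : m = m1 + m2 + m3 - N%:R ->
  \sum_(x \in adm23 m1 m2 m3 m) f x = \sum_(0 <= j < N.+1) f (m2 + m3 - j%:R).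
Proof.
move=> em; have -> : adm23 m1 m2 m3 m = [set m2 + m3 - j%:R | j in `I_N.+1].
  apply/seteqP; split=> x /=.
    case=> /is_natCP[k ek]; have ex : x = m2 + m3 - k%:R by rewrite -ek; ring.
    have -> : m1 + x - m = N%:R - k%:R by rewrite em ex; ring.
    by rewrite is_natCBnat => lekN; exists k.
  case=> k /= lekN <-; split.
    have -> : m2 + m3 - (m2 + m3 - k%:R) = k%:R by ring.
    exact: is_natC_nat.
  have -> : m1 + (m2 + m3 - k%:R) - m = N%:R - k%:R by rewrite em; ring.
  by rewrite is_natCBnat.
rewrite fsbig_image; last first.
  by move=> i j _ _ /addrI/oppr_inj/eqP; rewrite eqr_nat => /eqP.
by rewrite big_mkord (fsbig_ord _ _ (fun j => f (m2 + m3 - j%:R))).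
Qed.

End Regular.

Section Existence.
Local Open Scope classical_set_scope.
Context {R : realType}.
Variables (h : R[i]) (D : R[i] -> R[i] -> R[i] -> R[i]).
Hypothesis nat_nz : forall n, qnum h n.+1%:R != 0.
Variables (m1 m2 m3 m : R[i]) (N : nat).
Hypothesis em : m = m1 + m2 + m3 - N%:R.
Hypothesis reg23 : regular h (m2 + m3).
Hypothesis regm : regular h m.
Hypothesis D23_neq0 : forall j, D m2 m3 (m2 + m3 - j%:R) != 0.
Hypothesis D123_neq0 : forall j, (j <= N)%N -> D m1 (m2 + m3 - j%:R) m != 0.

(** Weight m leaves N + 1 points on the slice, a2 = m2 - j. At such a point the inner symbol of m23
    = m2 + m3 - k has m23 - (a2 + m3) = j - k, whence the triangular shape. *)
Definition evec23_top j k : R[i] :=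
  evec23 h D m1 m2 m3 (m2 + m3 - k%:R) m m (m1 - (N - j)%:R) (m2 - j%:R) m3.

Lemma evec23_top_lower j k : (j < k)%N -> evec23_top j k = 0.
Proof.
move=> ltjk; rewrite /evec23_top evec23E [q3j h D m2 _ _ _ _ _]q3j_eq0 ?mulr0 //.
have -> : m2 + m3 - k%:R - (m2 - j%:R + m3) = j%:R - k%:R by ring.
by rewrite is_natCBnat -ltnNge.
Qed.

(** On the diagonal a2 + m3 = m23, so both symbols sit at their highest weights, where they are
    products of nonzero factors. *)
Lemma evec23_top_diag j : (j <= N)%N -> evec23_top j j != 0.
Proof.
move=> lejN; rewrite /evec23_top evec23E.
have -> : m2 - j%:R + m3 = m2 + m3 - j%:R by ring.
have subE (x : R[i]) (k : nat) : x - (x - k%:R) = k%:R by ring.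
apply: mulf_neq0; apply: q3j_hw_neq0 => //; rewrite ?subE ?subrr ?is_natC_nat //.
- exact: (is_natC_nat 0).
- by rewrite natrB // em; ring.
- exact: D123_neq0.
- exact: (is_natC_nat 0).
- by ring.
Qed.

Lemma evec23_top_span u : (forall a1 a2, u a1 a2 m3 != 0 ->
    [/\ is_natC (m1 - a1), is_natC (m2 - a2) & a1 + a2 + m3 = m]) ->
  forall c, (forall j, (j <= N)%N ->
     u (m1 - (N - j)%:R) (m2 - j%:R) m3 = \sum_(0 <= k < N.+1) c k * evec23_top j k) ->
  forall a1 a2, u a1 a2 m3
    = \sum_(0 <= k < N.+1) c k * evec23 h D m1 m2 m3 (m2 + m3 - k%:R) m m a1 a2 m3.
Proof.
move=> usupp c uc a1 a2.
have [[n1 n2 es]|off] := pselect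
    [/\ is_natC (m1 - a1), is_natC (m2 - a2) & a1 + a2 + m3 = m].
  case/is_natCP: n1 n2 => [k1 e1] /is_natCP[k2 e2].
  have eN : N = (k1 + k2)%N.
    apply/eqP; rewrite -(eqr_nat R[i]) natrD -e1 -e2; apply/eqP.
    have -> : N%:R = m1 + m2 + m3 - m by rewrite em; ring.
    by rewrite -es; ring.
  have lek2 : (k2 <= N)%N by rewrite eN leq_addl.
  have := uc k2 lek2; rewrite /evec23_top {1 3}eN addnK -e1 -e2.
  have subE (x y : R[i]) : x - (x - y) = y by ring.
  by rewrite !subE.
rewrite [LHS](_ : _ = 0); last first.
  by apply/eqP; apply: contra_notT off => /usupp.
rewrite big1 // => k _.
rewrite [evec23 _ _ _ _ _ _ _ _ _ _ _](_ : _ = 0) ?mulr0 //.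
by apply/eqP; apply: contra_notT off => /evec23_supp[? ? _ ?]; split.
Qed.

Lemma q6jP m12 : regular h m12 ->
  is_q6j_family h D m1 m2 m12 m3 m (q6j h D m1 m2 m12 m3 m).
Proof.
move=> reg12; rewrite /q6j; apply: (@xgetPex _ _ [set c | is_q6j_family h D m1 m2 m12 m3 m c]).
have [c0 c0E] := triangular_solve evec23_top_lower evec23_top_diag
  (fun j => evec12 h D m1 m2 m3 m12 m m (m1 - (N - j)%:R) (m2 - j%:R) m3).
pose c x := if `[< adm23 m1 m2 m3 m x >] then c0 (natC (m2 + m3 - x)) else 0.
have cE j : (j <= N)%N -> c (m2 + m3 - j%:R) = c0 j.
  move=> lejN; rewrite /c asboolT; last first.
    split.
      have -> : m2 + m3 - (m2 + m3 - j%:R) = j%:R by ring.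
      exact: is_natC_nat.
    have -> : m1 + (m2 + m3 - j%:R) - m = N%:R - j%:R by rewrite em; ring.
    by rewrite is_natCBnat.
  have -> : m2 + m3 - (m2 + m3 - j%:R) = j%:R by ring.
  by rewrite natCE.
exists c; split=> [x xN|a an a1 a2 a3]; first by rewrite /c asboolF.
rewrite (adm23_sum _ em).
under eq_big_nat => j /andP[_ lejN] do rewrite cE //.
have r23 k : regular h (m2 + m3 - k%:R) by exact: regularB.
case/is_natCP: an => n en; have -> : a = m - n%:R by rewrite -en; ring.
elim: n {a en} a1 a2 a3 => [|n IHn] a1 a2 a3.
  rewrite subr0; move: a1 a2 a3.
  apply: (E3_inj nat_nz (m1 := m1) (m2 := m2) (m3 := m3)
    (u := evec12 h D m1 m2 m3 m12 m m)
    (v := fun a1 a2 a3 => \sum_(0 <= j < N.+1)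
       c0 j * evec23 h D m1 m2 m3 (m2 + m3 - j%:R) m m a1 a2 a3)).
  - move=> a1 a2 a3 N3; rewrite [LHS](_ : _ = 0); last first.
      by apply: contraNeq N3 => /evec12_supp[].
    rewrite big1 // => k _.
    rewrite [evec23 _ _ _ _ _ _ _ _ _ _ _](_ : _ = 0) ?mulr0 //.
    by apply: contraNeq N3 => /evec23_supp[].
  - move=> a1 a2 a3; rewrite E3_evec12 // subrr qnum0 mul0r E3_sum big1 // => k _.
    by rewrite (E3_evec23 D m1 m2 m3 nat_nz regm m a1 a2 a3 (r23 k)) subrr qnum0 mul0r mulr0.
  - apply: evec23_top_span => [a1 a2 /evec12_supp[]//|j lejN].
    exact: c0E.
have en : m + (m - n%:R) = 2 * m - n%:R by ring.
have an : is_natC (m - (m - n%:R)).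
  have -> : m - (m - n%:R) = n%:R by ring.
  exact: is_natC_nat.
have eS : m - n.+1%:R = m - n%:R - 1 by rewrite -natr1; ring.
(* [F3] passes from a to a - 1 with the same nonzero scalar [m + a] = [2m - n] on both sides, so the
   coefficients found at a = m serve for every a. *)
apply: (mulfI (regm n)); rewrite eS -en -(F3_evec12 D m1 m2 m3 nat_nz regm a1 a2 a3 reg12 an).
rewrite [LHS](_ : _ = F3 h m1 m2 m3 (fun a1 a2 a3 => \sum_(0 <= j < N.+1)
   c0 j * evec23 h D m1 m2 m3 (m2 + m3 - j%:R) m (m - n%:R) a1 a2 a3) a1 a2 a3).
  rewrite F3_sum big_distrr; apply: eq_bigr => k _ /=.
  by rewrite (F3_evec23 D m1 m2 m3 nat_nz regm a1 a2 a3 (r23 k) an); ring.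
by rewrite /F3 !IHn.
Qed.

Lemma evec12_expand m12 a1 a2 a3 : regular h m12 ->
  evec12 h D m1 m2 m3 m12 m m a1 a2 a3
  = \sum_(0 <= k < N.+1) q6j h D m1 m2 m12 m3 m (m2 + m3 - k%:R)
      * evec23 h D m1 m2 m3 (m2 + m3 - k%:R) m m a1 a2 a3.
Proof.
move=> reg12; have [_ /(_ m)] := q6jP reg12.
by rewrite subrr (is_natC_nat 0) => /(_ isT a1 a2 a3) ->; rewrite (adm23_sum _ em).
Qed.

End Existence.

(** * Inversion of q and reversal of the factors *)

Section Reversal.
Context {R : realType}.
Variables (h : R[i]) (D : R[i] -> R[i] -> R[i] -> R[i]).
Hypothesis nat_nz : forall n, qnum h n.+1%:R != 0.
Variables (m1 m2 m3 m : R[i]) (N : nat).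
Hypothesis em : m = m1 + m2 + m3 - N%:R.

Let casimir x : R[i] := x * (x - 1).

(** Product of the prefactors of two applications of [q3j_swap]: the [casimir] of the intermediate
    weight cancels and the signs combine to (-1)^N. *)
Definition reversal_factor a1 a2 a3 : R[i] :=
  (-1) ^+ N * qpow h (casimir m1 + casimir m2 + casimir m3 - casimir m
                      + 2 * (a1 * a2 + a1 * a3 + a2 * a3)).

Lemma reversal_factor_neq0 a1 a2 a3 : reversal_factor a1 a2 a3 != 0.
Proof. by apply: mulf_neq0; [rewrite signr_eq0 | exact: qpow_neq0]. Qed.

Lemma evec12_reversal k a1 a2 a3 : (k <= N)%N ->
  D m2 m3 (m2 + m3 - k%:R) = D m3 m2 (m2 + m3 - k%:R) ->
  D m1 (m2 + m3 - k%:R) m = D (m2 + m3 - k%:R) m1 m ->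
  evec12 h D m3 m2 m1 (m2 + m3 - k%:R) m m a3 a2 a1
  = reversal_factor a1 a2 a3
    * evec23 (- h) D m1 m2 m3 (m2 + m3 - k%:R) m m a1 a2 a3.
Proof.
move=> lekN D23 D1; rewrite evec12E evec23E.
rewrite (@q3j_swap _ h D (m2 + m3 - k%:R) m1 m (N - k)) //; last first.
  by rewrite natrB // em; ring.
rewrite (@q3j_swap _ h D m3 m2 (m2 + m3 - k%:R) k) //; last first.
  by ring.
rewrite (addrC a3 a2) /reversal_factor /casimir.
have -> : (-1) ^+ N = (-1) ^+ (N - k) * (-1) ^+ k :> R[i] by rewrite -exprD subnK.
set nu := m2 + m3 - k%:R.
have -> : qpow h (m1 * (m1 - 1) + m2 * (m2 - 1) + m3 * (m3 - 1) - m * (m - 1)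
    + 2 * (a1 * a2 + a1 * a3 + a2 * a3))
  = qpow h (nu * (nu - 1) + m1 * (m1 - 1) - m * (m - 1) + 2 * (a2 + a3) * a1)
    * qpow h (m3 * (m3 - 1) + m2 * (m2 - 1) - nu * (nu - 1) + 2 * a3 * a2).
  by rewrite -qpowD; congr qpow; ring.
by ring.
Qed.

Lemma evec23_reversal k a1 a2 a3 : (k <= N)%N ->
  D m1 m2 (m1 + m2 - k%:R) = D m2 m1 (m1 + m2 - k%:R) ->
  D m3 (m1 + m2 - k%:R) m = D (m1 + m2 - k%:R) m3 m ->
  evec23 h D m3 m2 m1 (m1 + m2 - k%:R) m m a3 a2 a1
  = reversal_factor a1 a2 a3
    * evec12 (- h) D m1 m2 m3 (m1 + m2 - k%:R) m m a1 a2 a3.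
Proof.
move=> lekN D12 D3; rewrite evec12E evec23E.
rewrite (@q3j_swap _ h D m3 (m1 + m2 - k%:R) m (N - k)) //; last first.
  by rewrite natrB // em; ring.
rewrite (@q3j_swap _ h D m2 m1 (m1 + m2 - k%:R) k) //; last first.
  by ring.
rewrite (addrC a2 a1) /reversal_factor /casimir.
have -> : (-1) ^+ N = (-1) ^+ (N - k) * (-1) ^+ k :> R[i] by rewrite -exprD subnK.
set nu := m1 + m2 - k%:R.
have -> : qpow h (m1 * (m1 - 1) + m2 * (m2 - 1) + m3 * (m3 - 1) - m * (m - 1)
    + 2 * (a1 * a2 + a1 * a3 + a2 * a3))
  = qpow h (m3 * (m3 - 1) + nu * (nu - 1) - m * (m - 1) + 2 * a3 * (a1 + a2))
    * qpow h (m2 * (m2 - 1) + m1 * (m1 - 1) - nu * (nu - 1) + 2 * a2 * a1).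
  by rewrite -qpowD; congr qpow; ring.
by ring.
Qed.

Hypothesis reg23 : regular h (m2 + m3).
Hypothesis regm : regular h m.
Hypothesis D23_neq0 : forall j, D m2 m3 (m2 + m3 - j%:R) != 0.
Hypothesis D123_neq0 : forall j, (j <= N)%N -> D m1 (m2 + m3 - j%:R) m != 0.

(* The 6j-symbols at q also expand the coupled vectors at q^-1: theta
   intertwines the two sets of vectors, up to one common scalar. *)
Lemma evec12_opp_expand m12 j : regular h m12 -> (j <= N)%N ->
  evec12 (- h) D m1 m2 m3 m12 m m (m1 - (N - j)%:R) (m2 - j%:R) m3
  = \sum_(0 <= k < N.+1) q6j h D m1 m2 m12 m3 m (m2 + m3 - k%:R)
      * evec23_top (- h) D m1 m2 m3 m N j k.
Proof.
move=> reg12 lejN; set a1 := m1 - _; set a2 := m2 - _.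
have ea : a1 + a2 + m3 = m by rewrite /a1 /a2 natrB // em; ring.
(* N + 1 terms of [theta] are enough, since m2 - a2 = j <= N. *)
have Mbig : ~~ is_natC (m2 - a2 - N.+1%:R).
  have -> : m2 - a2 - N.+1%:R = j%:R - N.+1%:R by rewrite /a2; ring.
  by rewrite is_natCBnat -ltnNge ltnS.
apply: (mulfI (qpow_neq0 h (- (2 * (m1 + m2 + m3 - m))))).
rewrite -(theta_evec12 D nat_nz m1 m12 ea Mbig) big_distrr /=.
rewrite (@eq_theta _ h m1 m2 N.+1 _ (fun x y => \sum_(0 <= k < N.+1)
  q6j h D m1 m2 m12 m3 m (m2 + m3 - k%:R)
  * evec23 h D m1 m2 m3 (m2 + m3 - k%:R) m m x y m3) a1 a2); last first.
  by move=> n _; rewrite (evec12_expand nat_nz em).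
rewrite (theta_sum _ _ _ _ _ _ (fun k x y =>
  evec23 h D m1 m2 m3 (m2 + m3 - k%:R) m m x y m3)).
apply: eq_big_nat => k /andP[_]; rewrite ltnS => lekN.
rewrite (theta_evec23 _ nat_nz) //.
- by rewrite mulrCA.
- exact: regularB.
- have -> : m2 + m3 - (m2 + m3 - k%:R) = k%:R by ring.
  exact: is_natC_nat.
- have -> : m1 + (m2 + m3 - k%:R) - m = N%:R - k%:R by rewrite em; ring.
  by rewrite is_natCBnat.
Qed.

End Reversal.

(** * From the genericity assumptions to the orthogonality relation *)

Section Generic.
Context {R : realType}.
Variables h l1 l2 l3 : R[i].
Hypothesis hq : generic_q h l1 l2 l3.

Lemma generic_nat_neq0 n : qnum h n.+1%:R != 0.
Proof.
have := @hq n.+1%:Z 0 0 0; rewrite /= !mulr0 !mul0r !addr0; apply.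
by rewrite pnatr_eq0.
Qed.

(** Genericity yields [x] <> 0 only for x <> 0; for x = 2(sum of the chosen weights) - n this is the
    assumption on partial sums, the Booleans marking the subset. *)
Lemma generic_regular (b1 b2 b3 : bool) :
  (forall I : {set 'I_3}, (0 < #|I|)%N -> forall n : nat,
     \sum_(i in I) tnth [tuple l1; l2; l3] i <> n%:R / 2) ->
  b1 || b2 || b3 -> regular h (b1%:R * l1 + b2%:R * l2 + b3%:R * l3).
Proof.
move=> hl b n; have := @hq (- n%:Z) b1%:Z b2%:Z b3%:Z.
rewrite mulrNz -!pmulrn.
have -> : - n%:R + 2 * b1%:R * l1 + 2 * b2%:R * l2 + 2 * b3%:R * l3
    = 2 * (b1%:R * l1 + b2%:R * l2 + b3%:R * l3) - n%:R by ring.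
apply; rewrite subr_eq0; apply/eqP => e.
pose I : {set 'I_3} := [set i : 'I_3 | nth false [:: b1; b2; b3] i]%SET.
have I0 : (0 < #|I|)%N.
  apply/card_gt0P; case/orP: b => [/orP[]|] b.
  - by exists (inord 0); rewrite inE inordK.
  - by exists (inord 1); rewrite inE inordK.
  - by exists (inord 2); rewrite inE inordK.
apply: (hl I I0 n); rewrite -e mulrC mulKf ?pnatr_eq0 //.
rewrite big_mkcond !big_ord_recl big_ord0 !inE /= addr0 addrA.
by case: b1 b2 b3 {e b I I0} => [] [] [] /=; rewrite !(mul1r, mul0r).
Qed.

End Generic.

Theorem theorem6p3 (R : realType) (h l1 l2 l3 : R[i])
    (D : R[i] -> R[i] -> R[i] -> R[i])
    (hD : Delta_root h D)
    (hq : generic_q h l1 l2 l3)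
    (hl : forall I : {set 'I_3}, (0 < #|I|)%N -> forall n : nat,
       \sum_(i in I) tnth [tuple l1; l2; l3] i <> n%:R / 2)
    (N : nat) (l123 : R[i]) (hl123 : l123 = l1 + l2 + l3 - N%:R)
    (mu nu : R[i])
    (hmu1 : exists k : nat, l2 + l3 - mu = k%:R)
    (hmu2 : exists k : nat, l1 + mu - l123 = k%:R)
    (hnu1 : exists k : nat, l2 + l3 - nu = k%:R)
    (hnu2 : exists k : nat, l1 + nu - l123 = k%:R) :
  \sum_(0 <= j < N.+1)
     (q6j h D l1 l2 (l1 + l2 - j%:R) l3 l123 mu
      * q6j h D l3 l2 nu l1 l123 (l1 + l2 - j%:R))
  = (mu == nu)%:R.
Proof.
have nat_nz := generic_nat_neq0 hq.
have reg b1 b2 b3 := generic_regular (b1 := b1) (b2 := b2) (b3 := b3) hq hl.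
have r1 : regular h l1 by have := reg true false false isT; rewrite !(mul1r, mul0r, addr0).
have r2 : regular h l2 by have := reg false true false isT; rewrite !(mul1r, mul0r, addr0, add0r).
have r3 : regular h l3 by have := reg false false true isT; rewrite !(mul1r, mul0r, addr0, add0r).
have r12 : regular h (l1 + l2) by
  have := reg true true false isT; rewrite !(mul1r, mul0r, addr0, add0r).
have r23 : regular h (l2 + l3) by
  have := reg false true true isT; rewrite !(mul1r, mul0r, addr0, add0r).
have r123 : regular h (l1 + l2 + l3) by
  have := reg true true true isT; rewrite !(mul1r, mul0r, addr0, add0r).
have rm : regular h l123 by rewrite hl123; exact: regularB.
have D12 J := Delta_root_regular J hD nat_nz r1 r2 r12.
have D23 J := Delta_root_regular J hD nat_nz r2 r3 r23.
have D1 j : (j <= N)%N -> D l1 (l2 + l3 - j%:R) l123 != 0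
    /\ D l1 (l2 + l3 - j%:R) l123 = D (l2 + l3 - j%:R) l1 l123.
  move=> lejN; have -> : l123 = l1 + (l2 + l3 - j%:R) - (N - j)%:R.
    by rewrite hl123 natrB //; ring.
  apply: (Delta_root_regular _ hD nat_nz r1); first exact: regularB.
  by rewrite !addrA; exact: regularB.
have D3 j : (j <= N)%N -> D l3 (l1 + l2 - j%:R) l123 != 0
    /\ D l3 (l1 + l2 - j%:R) l123 = D (l1 + l2 - j%:R) l3 l123.
  move=> lejN; have -> : l123 = l3 + (l1 + l2 - j%:R) - (N - j)%:R.
    by rewrite hl123 natrB //; ring.
  apply: (Delta_root_regular _ hD nat_nz r3); first exact: regularB.
  have -> : l3 + (l1 + l2 - j%:R) = l1 + l2 + l3 - j%:R by ring.
  exact: regularB.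
have index x : (exists k : nat, l2 + l3 - x = k%:R) ->
    (exists k : nat, l1 + x - l123 = k%:R) ->
    exists2 k, (k <= N)%N & x = l2 + l3 - k%:R.
  case=> k ek [k' ek']; exists k; last by rewrite -ek; ring.
  have -> : N = (k + k')%N.
    apply/eqP; rewrite -(eqr_nat R[i]) natrD -ek -ek' hl123; apply/eqP; ring.
  exact: leq_addr.
have [km lekm ->] := index mu hmu1 hmu2.
have [kn lekn ->] := index nu hnu1 hnu2.
have -> : (l2 + l3 - km%:R == l2 + l3 - kn%:R) = (km == kn).
  by rewrite (inj_eq (addrI _)) eqr_opp eqr_nat.
pose T := evec23_top (- h) D l1 l2 l3 l123 N.
have D23' j := (D23 j).1.
have D1' j lejN := (D1 j lejN).1.
have nat_nz' n : qnum (- h) n.+1%:R != 0 by rewrite qnum_opp.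
pose V j := q6j h D l3 l2 (l2 + l3 - kn%:R) l1 l123 (l1 + l2 - j%:R).
pose U j k := q6j h D l1 l2 (l1 + l2 - j%:R) l3 l123 (l2 + l3 - k%:R).
(* With nu fixed, both sides are coefficient vectors in the index of mu; they are compared after
   expansion in the e^(m23) at q^-1, independent on the slice. *)
apply: (@triangular_inj _ N T (@evec23_top_lower _ (- h) D l1 l2 l3 l123 N)
  (evec23_top_diag nat_nz' hl123 D23' D1')
  (fun k => \sum_(0 <= j < N.+1) U j k * V j) (fun k => (k == kn)%:R)) => // j lejN.
have -> : \sum_(0 <= k < N.+1) (k == kn)%:R * T j k = T j kn.
  rewrite (bigD1_seq kn) ?mem_index_iota ?iota_uniq //= eqxx mul1r big1 ?addr0 //.
  by move=> k /negbTE ->; rewrite mul0r.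
pose a1 := l1 - (N - j)%:R; pose a2 := l2 - j%:R.
(* This factor turns e^(nu) at q^-1 into the coupled vector of (l3, l2, l1) at q, which the symbols
   [V] expand. *)
apply: (mulfI (reversal_factor_neq0 h l1 l2 l3 l123 N a1 a2 l3)).
rewrite [RHS](_ : _ = evec12 h D l3 l2 l1 (l2 + l3 - kn%:R) l123 l123 l3 a2 a1); last first.
  by rewrite (evec12_reversal h hl123 a1 a2 l3 lekn (D23 kn).2 (D1 kn lekn).2).
have em' : l123 = l3 + l2 + l1 - N%:R by rewrite hl123; ring.
rewrite (evec12_expand nat_nz em') //; first last.
- exact: regularB.
- by move=> k /D3[]; rewrite (addrC l2).
- by move=> k; rewrite (addrC l2) -(D12 k).2; case: (D12 k).
- by rewrite addrC.
under eq_bigr do rewrite big_distrl /=.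
rewrite exchange_big big_distrr /=; apply: eq_big_nat => i /andP[_]; rewrite ltnS => leiN.
(* Reversing back gives e^(m12) at q^-1 with the same factor, and [U] expands it in the columns of
   [T]. *)
rewrite (addrC l2 l1) (evec23_reversal h hl123 a1 a2 l3 leiN (D12 i).2 (D3 i leiN).2).
rewrite (evec12_opp_expand nat_nz hl123 r23 rm D23' D1') //; last exact: regularB.
rewrite !big_distrr /=; apply: eq_bigr => k _.
by rewrite /U /V /T; ring.
Qed.
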